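(* Let $p$ be a prime, $q=p^a$, $A=\{\mathbf a_1,\dots,\mathbf a_N\}\subseteq\mathbb Z^n$, $\mathbf e=(e_1,\dots,e_n)\in\mathbb Z^n$, and for $\lambda=(\lambda_1,\dots,\lambda_N)\in\mathbb F_q^N$ let $f_\lambda=\sum_{j=1}^N\lambda_jx^{\mathbf a_j}\in\mathbb F_q[x_1^{\pm1},\dots,x_n^{\pm1}]$ and $$S(f_\lambda,\mathbf e)=\sum_{x\in(\mathbb F_q^\times)^n}\omega(x_1)^{-e_1}\cdots\omega(x_n)^{-e_n}\Psi(f_\lambda(x)).$$ Let $M=\mathbf e+(q-1)\mathbb Z^n$ and assume $U_M\neq\emptyset$. Define $$H(\lambda_1,\dots,\lambda_N)=(-1)^n\sum_{(\gamma_0,\dots,\gamma_{a-1})\in\Gamma_M}F_{\gamma_0}(\lambda)F_{\gamma_1}(\lambda^p)\cdots F_{\gamma_{a-1}}(\lambda^{p^{a-1}})\in\mathbb F_p[\lambda_1,\dots,\lambda_N],$$ where $\lambda^{p^k}=(\lambda_1^{p^k},\dots,\lambda_N^{p^k})$. Then $H$ is the Hasse invariant of the family: for every $\lambda\in\mathbb F_q^N$, $\pi^{-w_p(M)}S(f_\lambda,\mathbf e)$ lies in the ring of integers $\mathcal O$ of $K=\mathbb Q_p(\zeta_p,\zeta_{q-1})$ and its image in the residue field $\mathcal O/\pi\mathcal O=\mathbb F_q$ equals $H(\lambda_1,\dots,\lambda_N)$. Consequently, if $H(\lambda)\ne0$ then $\mathrm{ord}_p\,S(f_\lambda,\mathbf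 e)=w_p(M)/(p-1)$, and if $H(\lambda)=0$ then $\mathrm{ord}_p\,S(f_\lambda,\mathbf e)>w_p(M)/(p-1)$.
   Context: $\pi\in\overline{\mathbb Q}_p$ is fixed with $\pi^{p-1}=-p$; it is a uniformizer of $K=\mathbb Q_p(\zeta_p,\zeta_{q-1})$, whose residue field is identified with $\mathbb F_q$ so that the Teichmüller character $\omega:\mathbb F_q^\times\to K^\times$ satisfies $\omega(x)\equiv x$. $\zeta_p$ is the unique $p$-th root of unity with $\zeta_p\equiv1+\pi\pmod{\pi^2}$, $\psi_\pi:\mathbb F_p\to K^\times$ is the additive character with $\psi_\pi(1)=\zeta_p$, and $\Psi=\psi_\pi\circ\mathrm{Tr}_{\mathbb F_q/\mathbb F_p}$. $\mathrm{ord}_p$ is the $p$-adic valuation with $\mathrm{ord}_p\,p=1$. Notation: $\mathbb N=\{0,1,\dots\}$, $\mathbb NA=\{\sum_ic_i\mathbf a_i:c_i\in\mathbb N\}$; for $\gamma\in\mathbb NA$, $U^+(\gamma)=\{u\in\mathbb N^N:\sum_iu_i\mathbf a_i=\gamma\}$, $w(\gamma)=\min\{\sum_iu_i:u\in U^+(\gamma)\}$, $U^+_{\min}(\gamma)=\{u\in U^+(\gamma):\sum_iu_i=w(\gamma)\}$; $\gamma$ is good if all $u\in U^+_{\min}(\gamma)$ have $u_i\le p-1$, and then $F_\gamma(\lambda)=\sum_{u\in U^+_{\min}(\gamma)}\frac{\lambda_1^{u_1}\cdots\lambda_N^{u_N}}{u_1!\cdots u_N!}\in\mathbb F_p[\lambda]$.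 $U^+_{q-1}=\{u\in\mathbb Z^N:0\le u_i\le q-1\}$; for $u\in U^+_{q-1}$ with base-$p$ digits $u_i=\sum_{k=0}^{a-1}u^{(k)}_ip^k$, $w_p(u)=\sum_i\sum_ku^{(k)}_i$. $U_M=\{u\in U^+_{q-1}:\sum_iu_i\mathbf a_i\in M\}$, $w_p(M)=\min\{w_p(u):u\in U_M\}$. $\Gamma_M$ is the set of sequences $(\gamma_0,\dots,\gamma_{a-1})$ of good elements of $\mathbb NA$ with $\sum_{k}p^k\gamma_k\in M$ and $\sum_kw(\gamma_k)=w_p(M)$. *)

(* Defs.v *)
From HB Require Import structures.
(* mpoly must be imported before constructive_ereal: the converse order is a
   grammar conflict. *)
From mathcomp Require Import all_boot all_order all_algebra all_field.
From mathcomp Require Import mpoly.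
From mathcomp Require Import boolp classical_sets fsbigop constructive_ereal.

Set Implicit Arguments.
Unset Strict Implicit.
Unset Printing Implicit Defensive.

Import Order.TTheory GRing.Theory Num.Theory.

Local Open Scope classical_set_scope.
Local Open Scope ring_scope.

(* Junk value 0 when P is empty. *)
Definition min_nat (P : set nat) : nat :=
  if pselect (exists k, `[< P k >]) is left h then ex_minn h else 0%N.

(* Z_p as the inverse limit of the Z/p^k: [zres x k] is the representative in
   [0, p^k[ of the image of x in Z/p^k (the single compatibility condition
   below also forces this range). *)
Record padic_int (p : nat) (pr : prime p) := PadicInt {
  zres : nat -> nat;
  zresP : forall k, (zres k.+1 %% p ^ k)%N = zres k }.

Section PadicIntRing.
Variables (p : nat) (pr : prime p).
Local Notation Zp := (padic_int pr).
Local Open Scope nat_scope.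

HB.instance Definition _ := gen_eqMixin Zp.
HB.instance Definition _ := gen_choiceMixin Zp.

Lemma padic_intP (x y : Zp) : zres x =1 zres y -> x = y.
Proof.
case: x y => [x xP] [y yP] /= /funext exy; case: _ / exy in yP *.
by congr PadicInt; apply: Prop_irrelevance.
Qed.

Lemma zres_small (x : Zp) k : zres x k < p ^ k.
Proof. by rewrite -zresP ltn_mod expn_gt0 prime_gt0. Qed.

Lemma zres_mod (x : Zp) k : zres x k %% p ^ k = zres x k.
Proof. by rewrite modn_small ?zres_small. Qed.

Lemma zresD (x : Zp) k j : zres x (j + k) %% p ^ k = zres x k.
Proof.
elim: j => [|j IHj]; first by rewrite add0n zres_mod.
rewrite addSn -[RHS]IHj -(zresP x (j + k)) modn_dvdm //.
by rewrite dvdn_exp2l ?leq_addl.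
Qed.

Lemma mod_lim_subproof (f : nat -> nat) :
  (forall k, f k.+1 = f k %[mod p ^ k]) ->
  forall k, ((f k.+1 %% p ^ k.+1) %% p ^ k) = f k %% p ^ k.
Proof. by move=> fP k; rewrite modn_dvdm ?fP // dvdn_exp2l. Qed.

Definition mod_lim (f : nat -> nat) (fP : forall k, f k.+1 = f k %[mod p ^ k])
  : Zp := @PadicInt p pr (fun k => f k %% p ^ k) (mod_lim_subproof fP).

Lemma zconst_subproof (m : nat) k : m = m %[mod p ^ k]. Proof. by []. Qed.
Definition zconst m := mod_lim (zconst_subproof m).

Lemma zadd_subproof (x y : Zp) k :
  zres x k.+1 + zres y k.+1 = zres x k + zres y k %[mod p ^ k].
Proof. by rewrite -modnDm !zresP. Qed.
Definition zadd x y := mod_lim (zadd_subproof x y).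

Lemma zmul_subproof (x y : Zp) k :
  zres x k.+1 * zres y k.+1 = zres x k * zres y k %[mod p ^ k].
Proof. by rewrite -modnMm !zresP. Qed.
Definition zmul x y := mod_lim (zmul_subproof x y).

Lemma zopp_subproof (x : Zp) k :
  p ^ k.+1 - zres x k.+1 = p ^ k - zres x k %[mod p ^ k].
Proof.
apply/eqP; rewrite -(eqn_modDr (zres x k.+1)) subnK ?(ltnW (zres_small _ _)) //.
rewrite -modnDmr zresP subnK ?(ltnW (zres_small _ _)) // modnn.
by rewrite expnS modnMl.
Qed.
Definition zopp x := mod_lim (zopp_subproof x).

Fact zaddA : associative zadd.
Proof. by move=> x y z; apply: padic_intP => k /=; rewrite modnDmr modnDml addnA. Qed.
Fact zaddC : commutative zadd.
Proof. by move=> x y; apply: padic_intP => k /=; rewrite addnC. Qed.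
Fact zadd0 : left_id (zconst 0) zadd.
Proof. by move=> x; apply: padic_intP => k /=; rewrite mod0n add0n zres_mod. Qed.
Fact zaddN : left_inverse (zconst 0) zopp zadd.
Proof.
move=> x; apply: padic_intP => k /=.
by rewrite modnDml subnK ?(ltnW (zres_small _ _)) // modnn mod0n.
Qed.
HB.instance Definition _ :=
  GRing.isZmodule.Build Zp zaddA zaddC zadd0 zaddN.

Fact zmulA : associative zmul.
Proof. by move=> x y z; apply: padic_intP => k /=; rewrite modnMmr modnMml mulnA. Qed.
Fact zmulC : commutative zmul.
Proof. by move=> x y; apply: padic_intP => k /=; rewrite mulnC. Qed.
Fact zmul1 : left_id (zconst 1) zmul.
Proof. by move=> x; apply: padic_intP => k /=; rewrite modnMml mul1n zres_mod. Qed.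
Fact zmulDl : left_distributive zmul zadd.
Proof. by move=> x y z; apply: padic_intP => k /=; rewrite modnMml modnDm mulnDl. Qed.
Fact zone_neq0 : zconst 1 != 0%R.
Proof.
apply/eqP => /(congr1 (fun x => zres x 1)) /=.
by rewrite mod0n expn1 modn_small // prime_gt1.
Qed.
HB.instance Definition _ := GRing.Zmodule_isComNzRing.Build Zp
  zmulA zmulC zmul1 zmulDl zone_neq0.

Definition zunit : {pred Zp} := fun x => `[< exists y, y * x = 1 :> Zp >]%R.
Definition zinv (x : Zp) : Zp :=
  if pselect (exists y, y * x = 1)%R is left h then projT1 (cid h) else x.

Fact zmulV : {in zunit, left_inverse 1 zinv *%R}%R.
Proof. by move=> x /asboolP xP; rewrite /zinv; case: pselect => // h; case: cid. Qed.
Fact zunitPl (x y : Zp) : (y * x = 1)%R -> zunit x.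
Proof. by move=> xy; apply/asboolP; exists y. Qed.
Fact zinv_out : {in [predC zunit], zinv =1 id}.
Proof. by move=> x /asboolPn xP; rewrite /zinv; case: pselect. Qed.
HB.instance Definition _ :=
  GRing.ComNzRing_hasMulInverse.Build Zp zmulV zunitPl zinv_out.

Lemma zres_neq0 (x : Zp) : (x != 0)%R -> exists k, zres x k != 0.
Proof.
move=> x0; apply: contrapT => nx; case/eqP: x0; apply: padic_intP => k /=.
by rewrite mod0n; apply/eqP/negPn/negP => xk; apply: nx; exists k.
Qed.

Lemma zdvdn_shift (x : Zp) k j : (p ^ k %| zres x (j + k)) = (zres x k == 0).
Proof. by rewrite /dvdn zresD. Qed.

Fact zmul_eq0 (x y : Zp) : (x * y = 0 -> (x == 0) || (y == 0))%R.
Proof.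
move=> xy0; apply/orP; apply: contrapT => /not_orP[/negP x0 /negP y0].
have [i xi] := zres_neq0 x0; have [j yj] := zres_neq0 y0.
have := congr1 (fun z => zres z (j + i)) xy0.
rewrite /= mod0n => /eqP; apply/negP.
rewrite -/(dvdn _ _).
move: xi yj; rewrite -(zdvdn_shift x i j) -(zdvdn_shift y j i) [i + j]addnC.
set X := zres x _; set Y := zres y _ => xi yj.
have X0 : 0 < X by rewrite lt0n; apply: contraNneq xi => ->.
have Y0 : 0 < Y by rewrite lt0n; apply: contraNneq yj => ->.
have XY0 : 0 < X * Y by rewrite muln_gt0 X0.
move: xi yj; rewrite !pfactor_dvdn // lognM // -!ltnNge => xi yj.
by rewrite addnC -addSn leq_add // ltnW.
Qed.
HB.instance Definition _ := GRing.ComUnitRing_isIntegral.Build Zp zmul_eq0.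

End PadicIntRing.

Definition padic_field (p : nat) (pr : prime p) : fieldType :=
  {fraction (padic_int pr)}.

(* For z <> 0, ord z is the largest k such that z vanishes in Z/p^k. *)
Definition padic_int_ord (p : nat) (pr : prime p) (z : padic_int pr) :
    \bar rat :=
  if z == 0 then +oo%E
  else ((min_nat [set k | zres z k.+1 != 0%N])%:R : rat)%:E.

Section LocalField.
Variables (p : nat) (pr : prime p) (K : fieldExtType (padic_field pr)).

(* ord is the (unique) extension to K of the p-adic valuation of Q_p; as ord is
   multiplicative, it suffices to prescribe it on Z_p. *)
Record is_ordp (ord : K -> \bar rat) : Prop := IsOrdp {
  ordp_eqy : forall x, ord x = +oo%E <-> x = 0;
  ordp_neqNy : forall x, ord x != -oo%E;
  ordpM : forall x y, ord (x * y) = (ord x + ord y)%E;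
  ordpD : forall x y, (Order.min (ord x) (ord y) <= ord (x + y)%R)%E;
  ordp_ext : forall z : padic_int pr,
    ord ((tofrac z : padic_field pr)%:A) = padic_int_ord z }.

Definition integers (ord : K -> \bar rat) : set K := [set x | (0 <= ord x)%E].

Definition cong (ord : K -> \bar rat) (m x y : K) : Prop :=
  exists2 z, integers ord z & x = y + m * z.

(* red induces an isomorphism O / pi O -> F; its values outside O are
   irrelevant. *)
Record residue_map (F : finFieldType) (ord : K -> \bar rat) (pi : K)
    (red : K -> F) : Prop := ResidueMap {
  red_1 : red 1 = 1;
  red_D : forall x y, integers ord x -> integers ord y ->
    red (x + y) = red x + red y;
  red_M : forall x y, integers ord x -> integers ord y ->
    red (x * y) = red x * red y;
  red_ker : forall x, integers ord x -> (red x = 0 <-> cong ord pi x 0);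
  red_surj : forall t, exists2 x, integers ord x & red x = t }.

(* Only the values of omega on F^* matter. *)
Record is_teichmuller (F : finFieldType) (ord : K -> \bar rat) (red : K -> F)
    (omega : F -> K) : Prop := IsTeichmuller {
  teich1 : omega 1 = 1;
  teichM : forall x y, x != 0 -> y != 0 -> omega (x * y) = omega x * omega y;
  teich_int : forall x, x != 0 -> integers ord (omega x);
  teich_red : forall x, x != 0 -> red (omega x) = x }.

End LocalField.

Section CharacterSum.
Variables (p : nat) (F : finFieldType) (charF : p \in [pchar F]).
Local Notation Fq := (pPrimeCharType charF).

(* The Galois trace lies in the line spanned by 1; coord reads off its F_p
   coefficient. *)
Definition absTr (x : F) : 'F_p :=
  coord [tuple (1 : Fq)] ord0 (galTrace 1%AS {:Fq} (x : Fq)).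

Definition psi_pi (K : fieldType) (zp : K) (t : 'F_p) : K := zp ^+ t.

Definition Psi (K : fieldType) (zp : K) (x : F) : K := psi_pi zp (absTr x).

Definition laurent_eval (n N : nat) (A : 'I_N -> 'rV[int]_n)
    (lam : 'I_N -> F) (x : 'I_n -> F) : F :=
  \sum_j lam j * \prod_i x i ^ A j 0 i.

Definition expsum (K : fieldType) (zp : K) (omega : F -> K)
    (n N : nat) (A : 'I_N -> 'rV[int]_n) (e : 'rV[int]_n) (lam : 'I_N -> F) : K :=
  \sum_(x : {ffun 'I_n -> F} | [forall i, x i != 0])
    (\prod_i omega (x i) ^ (- e 0 i)) * Psi zp (laurent_eval A lam x).

Definition eval_Fp (N : nat) (P : {mpoly 'F_p[N]}) (lam : 'I_N -> F) : F :=
  (map_mpoly (in_alg Fq) P).@[lam].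

End CharacterSum.

Section Hasse.
Variables (p a n N : nat) (A : 'I_N -> 'rV[int]_n).
Local Notation q := (p ^ a)%N.

Definition Uplus (gamma : 'rV[int]_n) : set 'X_{1..N} :=
  [set u : 'X_{1..N} | \sum_i A i *+ u i = gamma].

Definition NA : set 'rV[int]_n := [set gamma | Uplus gamma !=set0].

Definition weight (gamma : 'rV[int]_n) : nat :=
  min_nat [set mdeg u | u in Uplus gamma].

Definition Umin (gamma : 'rV[int]_n) : set 'X_{1..N} :=
  [set u : 'X_{1..N} | Uplus gamma u /\ mdeg u = weight gamma].

Definition good (gamma : 'rV[int]_n) : Prop :=
  forall u, Umin gamma u -> forall i, (u i <= p.-1)%N.

(* [\sum_(u \in D)] is the finitely supported sum; Umin gamma is finite. *)
Definition Fpoly (gamma : 'rV[int]_n) : {mpoly 'F_p[N]} :=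
  \sum_(u \in Umin gamma) (\prod_i (u i)`!%:R : 'F_p)^-1 *: 'X_[u].

Definition wp (u : {ffun 'I_N -> 'I_q}) : nat :=
  (\sum_i \sum_(k < a) (u i %/ p ^ k) %% p)%N.

Definition UM (M : set 'rV[int]_n) : set {ffun 'I_N -> 'I_q} :=
  [set u : {ffun 'I_N -> 'I_q} | M (\sum_i A i *+ u i)].

Definition wpM (M : set 'rV[int]_n) : nat := min_nat [set wp u | u in UM M].

Definition GammaM (M : set 'rV[int]_n) : set {ffun 'I_a -> 'rV[int]_n} :=
  [set g : {ffun 'I_a -> 'rV[int]_n} | [/\ forall k, NA (g k) /\ good (g k),
              M (\sum_k g k *+ p ^ k) &
              (\sum_k weight (g k))%N = wpM M]].

(* GammaM M is finite: its entries have weight at most wpM M. *)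
Definition hasse (M : set 'rV[int]_n) : {mpoly 'F_p[N]} :=
  (-1) ^+ n * \sum_(g \in GammaM M)
    \prod_(k < a) (Fpoly (g k) \mPo [tuple 'X_i ^+ (p ^ k) | i < N]).

Definition latticeM (e : 'rV[int]_n) : set 'rV[int]_n :=
  [set e + z *+ q.-1 | z in [set: 'rV[int]_n]].

End Hasse.

(* Main.v *)
Require Import Defs.
From HB Require Import structures.
From mathcomp Require Import all_boot all_order all_algebra all_fingroup all_solvable
  all_field.
From mathcomp Require Import mpoly.
From mathcomp Require Import boolp classical_sets fsbigop constructive_ereal.
From mathcomp Require Import zify ring lra.
Set Implicit Arguments.
Unset Strict Implicit.
Unset Printing Implicit Defensive.
Import Order.TTheory GRing.Theory Num.Theory.
Local Open Scope classical_set_scope.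
Local Open Scope ring_scope.

(** Let [T] be the Teichmueller lift, with [T 0 = 0].  As a function on [F_q] the
    additive character expands as [Psi t = \sum_(m < q) C_m T(t)^m], where, away
    from [m = 0] and [m = q - 1], [C_m] is the Gauss sum of [T^-m] divided by
    [q - 1].  Stickelberger's congruence says that [C_m] is
    [pi^s(m) / \prod_k m_k!] to first order, [m_k] being the base-[p] digits of
    [m] and [s(m)] their sum.  It follows by induction on [m]: Frobenius gives
    [C_(pm) = C_m]; when [p] does not divide [m], the Gauss sums satisfy
    [g_1 g_(m-1) = J g_m] with a Jacobi sum [J = - m] modulo [pi]; and [C_1] is
    read off the trace.

    Expanding [Psi (f_lam x)] and summing over [x], orthogonality leaves
    [S = (q - 1)^n \sum_(u in U_M) \prod_j C_(u_j) T(lam_j)^(u_j)], so only the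
    [u] of minimal digit weight contribute modulo [pi^(w_p(M) + 1)].  These [u]
    correspond to the sequences in [Gamma_M] together with a minimal
    representation of each entry: replacing a digit vector of [u] by another
    representation of the same lattice point stays in [M], and if some entry is
    at least [p] then a carry ([p] units at place [k] become one unit at place
    [k + 1] modulo [a], as [p^a = 1] modulo [q - 1]) would lower the weight. *)

(** * Minima of sets of naturals and the order of [p] *)

Lemma min_natP (P : set nat) :
  P !=set0 -> P (min_nat P) /\ forall k, P k -> (min_nat P <= k)%N.
Proof.
case=> k0 Pk0; rewrite /min_nat; case: pselect => [h|]; last first.
  by case; exists k0; apply/asboolP.
case: ex_minnP => m /asboolP Pm mmin; split=> // k Pk.
by apply: mmin; apply/asboolP.
Qed.

Lemma zres_nat (p : nat) (pr : prime p) m k :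
  zres (m%:R : padic_int pr) k = (m %% p ^ k)%N.
Proof.
elim: m => [|m IHm] //;
  rewrite -natr1 -[LHS]/((zres (m%:R : padic_int pr) k + 1 %% p ^ k) %% p ^ k)%N.
by rewrite IHm modnDm addn1.
Qed.

(** The residue of [p] is zero modulo [p] and nonzero modulo [p ^ 2]; as the order tests [zres] at
    [k.+1], the minimum is attained at 1. *)
Lemma padic_int_ord_p (p : nat) (pr : prime p) :
  padic_int_ord (p%:R : padic_int pr) = 1%:E.
Proof.
have p1 := prime_gt1 pr; have res2 : zres (p%:R : padic_int pr) 2 = p.
  by rewrite zres_nat modn_small // expnS expn1 ltn_Pmull // prime_gt0.
rewrite /padic_int_ord ifF; last first.
  apply/negbTE/eqP => /(congr1 (fun x => zres x 2)); rewrite res2 /= mod0n => p0.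
  by rewrite p0 in p1.
have [] := @min_natP [set k | zres (p%:R : padic_int pr) k.+1 != 0%N].
  by exists 1%N; rewrite /= res2 -lt0n prime_gt0.
move=> m0 /(_ 1%N); rewrite /= res2 -lt0n prime_gt0 // => /(_ isT).
move: m0; case: min_nat => [|[|//]] //=.
by rewrite zres_nat expn1 modnn.
Qed.

(** * The valuation of [K] and leading terms in powers of [pi] *)

Section Valuation.
Variables (p : nat) (pr : prime p) (K : fieldExtType (padic_field pr)).
Variables (ord : K -> \bar rat) (ordP : is_ordp ord).

Lemma ord_fin x : x != 0 -> exists r : rat, ord x = r%:E.
Proof.
move=> x0; case E : (ord x) => [r||]; first by exists r.
  by case/eqP: x0; apply/(ordp_eqy ordP).
by have := ordp_neqNy ordP x; rewrite E.
Qed.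

Lemma ordp0 : ord 0 = +oo%E. Proof. exact/(ordp_eqy ordP). Qed.

Lemma ordp1 : ord 1 = 0%E.
Proof.
have [r Er] := ord_fin (oner_neq0 K).
have := ordpM ordP 1 1; rewrite mulr1 Er -EFinD => -[] rr; congr EFin; lra.
Qed.

Lemma ordpN1 : ord (-1) = 0%E.
Proof.
have [r Er] : exists r : rat, ord (-1) = r%:E by apply: ord_fin;
  rewrite oppr_eq0 oner_neq0.
have := ordpM ordP (-1) (-1); rewrite mulrNN mulr1 ordp1 Er -EFinD => -[] rr.
by congr EFin; lra.
Qed.

Lemma ordpX x (r : rat) k : ord x = r%:E -> ord (x ^+ k) = (k%:R * r)%:E.
Proof.
move=> Er; elim: k => [|k IHk]; first by rewrite expr0 ordp1 mul0r.
by rewrite exprS (ordpM ordP) Er IHk -EFinD -natr1 mulrDl mul1r addrC.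
Qed.

Lemma ordpV x (r : rat) : ord x = r%:E -> ord x^-1 = (- r)%:E.
Proof.
move=> Er; have x0 : x != 0 by apply: contra_eq_neq Er => ->; rewrite ordp0.
have [s Es] : exists s : rat, ord x^-1 = s%:E by apply: ord_fin; rewrite invr_eq0.
have := ordpM ordP x x^-1; rewrite divff // ordp1 Er Es -EFinD => -[] rs.
by congr EFin; lra.
Qed.

Lemma ord_p : ord p%:R = 1%:E.
Proof.
have := ordp_ext ordP p%:R; rewrite padic_int_ord_p.
by rewrite rmorph_nat scaler_nat.
Qed.

Lemma integersD x y : integers ord x -> integers ord y -> integers ord (x + y).
Proof.
rewrite /integers /= => x0 y0; apply: le_trans (ordpD ordP x y).
by rewrite le_min x0.
Qed.
Lemma integersM x y : integers ord x -> integers ord y -> integers ord (x * y).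
Proof. by rewrite /integers /= => x0 y0; rewrite (ordpM ordP) adde_ge0. Qed.
Lemma integers1 : integers ord 1. Proof. by rewrite /integers /= ordp1. Qed.
Lemma integers0 : integers ord 0. Proof. by rewrite /integers /= ordp0. Qed.
Lemma integersN x : integers ord x -> integers ord (- x).
Proof. by move=> x0; rewrite -mulN1r; apply: integersM => //;
  rewrite /integers /= ordpN1. Qed.

Variables (F : finFieldType) (pi : K) (red : K -> F).
Hypotheses (redP : residue_map ord pi red) (piP : pi ^+ p.-1 = - p%:R).

Let p1_gt0 : (0 < p.-1)%N. Proof. by have := prime_gt1 pr; lia. Qed.

Lemma ord_pi : ord pi = (p.-1%:R^-1 : rat)%:E.
Proof.
have pip : ord (pi ^+ p.-1) = 1%:E by rewrite piP -mulN1r (ordpM ordP) ordpN1 add0e ord_p.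
have pi0 : pi != 0.
  apply/eqP => pi0; move: pip; rewrite pi0 expr0n; case: eqP p1_gt0 => [->//|_ _].
  by rewrite ordp0.
have [r Er] := ord_fin pi0; move: pip; rewrite (ordpX _ Er) => -[] e1.
rewrite Er; congr EFin.
have pn0 : p.-1%:R != 0 :> rat by rewrite pnatr_eq0 -lt0n.
by apply: (mulfI pn0); rewrite e1 divff.
Qed.

Lemma pi_neq0 : pi != 0.
Proof. by apply/eqP => pi0; have := ord_pi; rewrite pi0 ordp0. Qed.

Lemma ord_piX k : ord (pi ^+ k) = (k%:R / p.-1%:R : rat)%:E.
Proof. exact: ordpX ord_pi. Qed.

Lemma int_pi : integers ord pi.
Proof. by rewrite /integers /= ord_pi lee_fin invr_ge0 ler0n. Qed.

Lemma red0 : red 0 = 0.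
Proof. by apply: (addrI (red 0)); rewrite -(red_D redP) ?addr0; try exact: integers0. Qed.

Lemma redN x : integers ord x -> red (- x) = - red x.
Proof.
move=> xi; apply/eqP; rewrite -addr_eq0 -(red_D redP) //; last exact: integersN.
by rewrite addNr red0.
Qed.

Lemma red_pi_mul z : integers ord z -> red (pi * z) = 0.
Proof.
move=> zi; apply/(red_ker redP); first exact: integersM int_pi zi.
by exists z; rewrite // add0r.
Qed.

(** Let [v] lift the inverse residue. Then [x * v - 1 = pi * z] has positive order, so the
    ultrametric inequality for [1 = x * v - pi * z] forces [ord (x * v) <= 0], while both factors
    have order at least 0. *)
Lemma red_unit x : integers ord x -> red x != 0 -> ord x = 0%E.
Proof.
move=> xi rx; have [v vi rv] := red_surj redP (red x)^-1.
have xvi : integers ord (x * v) by exact: integersM.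
have : red (x * v - 1) = 0.
  by rewrite (red_D redP) ?redN ?(red_M redP) ?(red_1 redP) ?rv ?divff ?subrr //;
     (try apply: integersN); exact: integers1.
move=> /(red_ker redP) [|z zi].
  by apply: integersD => //; apply: integersN; exact: integers1.
rewrite add0r => Exv.
have x0 : x != 0 by apply: contraNneq rx => ->; rewrite red0.
have v0 : v != 0.
  apply/eqP => v0; move: rv; rewrite v0 red0 => /esym/eqP; rewrite invr_eq0; exact/negP.
have [r Er] := ord_fin x0; have [s Es] := ord_fin v0.
move: xi vi; rewrite /integers /= Er Es !lee_fin => r0 s0.
have: (Order.min (ord (x * v)) (ord (- (pi * z))) <= ord 1)%E.
  by rewrite (_ : 1 = x * v + - (pi * z)) ?(ordpD ordP) // -Exv; ring.
rewrite (ordpM ordP) -mulN1r (ordpM ordP) ordpN1 add0e (ordpM ordP) ord_pi Er Es ordp1.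
rewrite ge_min => /orP[|].
  by rewrite -EFinD lee_fin => rs; congr EFin; lra.
rewrite leNgt => /negP[]; apply: (@lt_le_trans _ _ (p.-1%:R^-1 : rat)%:E).
  by rewrite lte_fin invr_gt0 ltr0n.
by rewrite leeDl.
Qed.

(* [x] is [c] times [pi ^+ k] up to higher order in [pi]. *)
Definition lead k (x : K) (c : F) :=
  integers ord (pi ^- k * x) /\ red (pi ^- k * x) = c.

Lemma lead0 k : lead k 0 0.
Proof. by rewrite /lead mulr0; split; [exact: integers0|exact: red0]. Qed.

Lemma leadD k x y c d : lead k x c -> lead k y d -> lead k (x + y) (c + d).
Proof.
move=> [xi <-] [yi <-]; rewrite /lead mulrDr; split; first exact: integersD.
by rewrite (red_D redP).
Qed.

Lemma lead_sum k (I : Type) (r : seq I) (P : pred I) (f : I -> K) (c : I -> F) :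
  (forall i, P i -> lead k (f i) (c i)) ->
  lead k (\sum_(i <- r | P i) f i) (\sum_(i <- r | P i) c i).
Proof. by move=> fP; apply: (big_rec2 (lead k)) => [|i y x Pi yx];
  [exact: lead0|apply: leadD yx; exact: fP]. Qed.

Lemma leadN k x c : lead k x c -> lead k (- x) (- c).
Proof. by move=> [xi <-]; rewrite /lead mulrN; split; [exact: integersN|exact: redN]. Qed.

Lemma leadM k l x y c d : lead k x c -> lead l y d -> lead (k + l) (x * y) (c * d).
Proof.
move=> [xi <-] [yi <-]; rewrite /lead.
have -> : pi ^- (k + l) * (x * y) = (pi ^- k * x) * (pi ^- l * y).
  by rewrite exprD invfM; ring.
by split; [exact: integersM|exact: (red_M redP)].
Qed.

Lemma lead1 : lead 0 1 1.
Proof. by rewrite /lead expr0 invr1 mul1r; split;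
  [exact: integers1|exact: (red_1 redP)]. Qed.

Lemma lead_prod (I : Type) (r : seq I) (P : pred I) (k : I -> nat)
    (f : I -> K) (c : I -> F) :
  (forall i, P i -> lead (k i) (f i) (c i)) ->
  lead (\sum_(i <- r | P i) k i) (\prod_(i <- r | P i) f i) (\prod_(i <- r | P i) c i).
Proof. by move=> fP; apply: (big_rec3 lead) => [|i z y x Pi zyx];
  [exact: lead1|apply: leadM zyx; exact: fP]. Qed.

Lemma leadX k x c m : lead k x c -> lead (m * k) (x ^+ m) (c ^+ m).
Proof.
move=> xc; elim: m => [|m IHm]; first exact: lead1.
by rewrite !exprS mulSn; exact: leadM.
Qed.

Lemma lead_nat m : lead 0 m%:R m%:R.
Proof.
elim: m => [|m IHm]; first exact: lead0.
by rewrite -!natr1; apply: leadD => //; exact: lead1.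
Qed.

Lemma lead_pi k : lead k (pi ^+ k) 1.
Proof. by rewrite /lead mulVf ?expf_neq0 ?pi_neq0 //; split;
  [exact: integers1|exact: (red_1 redP)]. Qed.

(** A factor [pi] is left over in [pi ^- k * x]. This is how terms of higher order drop out of a
    congruence. *)
Lemma lead_lt k l x c : (k < l)%N -> lead l x c -> lead k x 0.
Proof.
move=> kl [xi _]; rewrite /lead.
have -> : pi ^- k * x = pi * (pi ^+ (l - k.+1) * (pi ^- l * x)).
  rewrite mulrA -exprS mulrA; congr (_ * _).
  rewrite -subSn //
    subSS -[X in _ = _ / pi ^+ X](subnK (ltnW kl)) exprD invfM mulrA divff ?mul1r //.
  by rewrite expf_neq0 ?pi_neq0.
have xi' : integers ord (pi ^+ (l - k.+1) * (pi ^- l * x)).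
  by apply: integersM => //; case: (lead_pi 0);
    rewrite /integers /= ord_piX lee_fin => *; rewrite divr_ge0.
by split; [exact: integersM int_pi _|exact: red_pi_mul].
Qed.

(** By [red_unit], [u] has order 0, so a congruence for [u * x] can be solved for [x]. It serves to
    divide by [q - 1] and by Jacobi sums. *)
Lemma lead_div k u x c d : c != 0 -> lead 0 u c -> lead k (u * x) d ->
  lead k x (c^-1 * d).
Proof.
move=> c0 [ui uc] [xi xd].
rewrite /lead; move: ui uc; rewrite expr0 invr1 mul1r => ui uc.
have u0 : u != 0 by apply: contraNneq c0 => u0; rewrite -uc u0 red0.
have ou : ord u = 0%E by apply: red_unit => //; rewrite uc.
have vi : integers ord u^-1 by rewrite /integers /= (ordpV ou) oppr0.
have Ex : pi ^- k * x = u^-1 * (pi ^- k * (u * x)).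
  by field; rewrite u0 expf_neq0 ?pi_neq0.
have xi' : integers ord (pi ^- k * x) by rewrite Ex; exact: integersM.
split=> //; apply: (mulfI c0); rewrite mulVKf // -xd -uc -(red_M redP) //.
by congr red; ring.
Qed.

Lemma lead_ord_eq k x c : lead k x c -> c != 0 -> ord x = (k%:R / p.-1%:R : rat)%:E.
Proof.
move=> [xi xc] c0; have : ord (pi ^- k * x) = 0%E by apply: red_unit => //; rewrite xc.
have -> : ord x = (ord (pi ^+ k) + ord (pi ^- k * x))%E.
  by rewrite -(ordpM ordP) mulrA divff ?mul1r ?expf_neq0 ?pi_neq0.
by move=> ->; rewrite adde0 ord_piX.
Qed.

(** A zero residue yields one more factor [pi], which adds [1 / (p - 1)] to the order. *)
Lemma lead_ord_gt k x : lead k x 0 -> ((k%:R / p.-1%:R : rat)%:E < ord x)%E.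
Proof.
move=> [xi /(red_ker redP) []// z zi]; rewrite add0r => Ex.
have -> : x = pi ^+ k.+1 * z.
  by rewrite exprSr -mulrA -Ex mulrA divff ?mul1r ?expf_neq0 ?pi_neq0.
rewrite (ordpM ordP) ord_piX; apply: (@lt_le_trans _ _ (k.+1%:R / p.-1%:R : rat)%:E).
  by rewrite lte_fin ltr_pM2r ?ltr_nat // invr_gt0 ltr0n.
by rewrite leeDl.
Qed.

End Valuation.

(** * Sums over cyclic groups and primitive roots of finite fields *)

Lemma big_cycle (R : Type) (idx : R) (op : Monoid.com_law idx)
    (gT : finGroupType) (x : gT) (f : gT -> R) :
  \big[op/idx]_(y in <[x]>%g) f y = \big[op/idx]_(k < #[x]%g) f (x ^+ k)%g.
Proof.
have -> : <[x]>%g = [set (x ^+ k)%g | k : 'I_#[x]%g]%SET.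
  apply/setP => y; apply/idP/imsetP => [/cyclePmin[k kx ->]|[k _ ->]].
    by exists (Ordinal kx).
  exact: mem_cycle.
rewrite big_imset //= => i j _ _ /eqP; rewrite eq_expg_mod_order !modn_small //.
by move/eqP/val_inj.
Qed.

(** The nonzero elements are [#|F| - 1] distinct roots of unity of that order, and so many force a
    primitive one. *)
Lemma fin_field_prim_root (F : finFieldType) :
  exists g : F, (#|F|.-1).-primitive_root g.
Proof.
have F1 := finNzRing_gt1 F.
have: has (#|F|.-1).-primitive_root (enum (predC1 (0 : F))).
  apply: has_prim_root; rewrite ?enum_uniq //; first by rewrite -ltnS prednK // ltnW.
    apply/allP => x; rewrite mem_enum /= inE => x0; apply/unity_rootP.
    by apply: (mulfI x0); rewrite -exprS prednK ?expf_card ?mulr1 // ltnW.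
  by rewrite -cardE cardC1.
by case/hasP => g _ gP; exists g.
Qed.

(** * The absolute trace and the additive character [Psi] *)

Section Trace.
Variables (p a : nat) (pr : prime p) (F : finFieldType).
Hypotheses (cardF : #|F| = (p ^ a)%N) (charF : p \in [pchar F]).
Local Notation L := (pPrimeCharType charF).

(** The Galois group over the prime field is generated by Frobenius and its order is the dimension
    [a], so the Galois trace is a sum of Frobenius powers. *)
Lemma absTrE (x : F) : (absTr charF x)%:R = \sum_(k < a) x ^+ (p ^ k).
Proof.
have dimL : \dim {: L} = a.
  by rewrite [LHS](pprimeChar_dimf charF) -[#|_|]/#|F| cardF pfactorK.
have gal1 : galois 1%AS {: L} by apply: finField_galois; exact: sub1v.
have [al /eqP defG alE] := @finField_galois_generator _ _ 1%AS {:L}%AS (sub1v _).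
have alX k (y : L) : (al ^+ k)%g y = y ^+ (p ^ k).
  elim: k => [|k IHk]; first by rewrite expg0 gal_id.
  rewrite expgSr galM ?memvf // IHk alE ?memvf // -exprM card_Fp // dimv1 expn1.
  by rewrite expnSr.
have oal : #[al]%g = a.
  by rewrite orderE -defG -(galois_dim gal1) dimv1 divn1 dimL.
have trE : galTrace 1%AS {:L} (x : L) = \sum_(k < a) (x : L) ^+ (p ^ k).
  rewrite /galTrace defG big_cycle oal.
  by apply: eq_bigr => k _; rewrite alX.
rewrite -[RHS]trE /absTr.
have := mem_galTrace gal1 (memvf (x : L)).
set t := galTrace _ _ _ => t1.
have: t \in <<[tuple (1%R : L)]>>%VS by rewrite span_seq1.
by move/coord_span => {2}->; rewrite big_ord1 /= -[RHS]/(_%:R * 1) mulr1.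
Qed.

(** Lets identities between traces be checked in [F], where [absTrE] applies. *)
Lemma natr_Fp_inj (s t : 'F_p) : (s%:R : F) = t%:R -> s = t.
Proof.
have aux (u v : 'F_p) : (u <= v)%N -> (u%:R : F) = v%:R -> u = v.
  move=> uv /esym/eqP; rewrite -subr_eq0 -natrB // -(dvdn_pcharf charF) => dvd.
  have vp : (v < p)%N by rewrite -[X in (_ < X)%N](Fp_cast pr).
  apply: val_inj; apply/eqP; rewrite eqn_leq uv -subn_eq0 eqn0Ngt /=.
  by apply/negP => /(dvdn_leq)/(_ dvd); lia.
case/orP: (leq_total s t) => st; first exact: aux.
by move/esym/aux => /(_ st).
Qed.

Lemma absTrD (x y : F) : absTr charF (x + y) = absTr charF x + absTr charF y.
Proof. by rewrite /absTr raddfD linearD. Qed.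

(** Frobenius permutes the terms of [absTrE] cyclically, since [x ^+ (p ^ a) = x]. *)
Lemma absTr_frob (x : F) : absTr charF (x ^+ p) = absTr charF x.
Proof.
apply: natr_Fp_inj; rewrite !absTrE.
under eq_bigr do rewrite -exprM -expnS.
case: a cardF => [|b] cF; first by have := finNzRing_gt1 F; rewrite cF.
by rewrite big_ord_recr big_ord_recl /= expr1 -cF expf_card addrC.
Qed.

(** Otherwise the trace polynomial, of degree at most [p ^ a.-1], would have all [p ^ a] elements of
    [F] as roots. *)
Lemma absTr_neq0 : exists x : F, absTr charF x != 0.
Proof.
apply: contrapT => /forallNP tr0.
pose P : {poly F} := \sum_(k < a) 'X^(p ^ k).
have a0 : (0 < a)%N.
  by case: a cardF => // cF; have := finNzRing_gt1 F; rewrite cF.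
(* The coefficient of ['X] is 1, coming from [k = 0] alone. *)
have P0 : P != 0.
  apply/eqP => /(congr1 (fun P : {poly F} => P`_1)); rewrite coef0 coef_sum.
  case: a a0 => // b _; rewrite big_ord_recl /= coefX eqxx big1 ?addr0 => [/eqP|i _].
    by rewrite oner_eq0.
  by rewrite coefXn eqn_leq [(p ^ _ <= 1)%N]leqNgt andbC -{1}(expn0 p) ltn_exp2l
    ?prime_gt1.
have : (#|F| <= (p ^ a.-1))%N.
  rewrite cardE -ltnS; apply: leq_trans (max_poly_roots P0 _ (enum_uniq F)) _.
    apply/allP => x _; rewrite /root /P horner_sum.
    under eq_bigr do rewrite hornerXn.
    by rewrite -absTrE; have /negP/negPn/eqP-> := tr0 x.
  apply: leq_trans (size_sum _ _ _) _; apply/bigmax_leqP => i _.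
  by rewrite size_polyXn ltnS leq_exp2l ?prime_gt1 // -ltnS prednK.
by rewrite cardF leq_exp2l ?prime_gt1 //; lia.
Qed.

Variables (K : fieldType) (zp : K).
Hypothesis zpP : p.-primitive_root zp.

Lemma PsiD x y : Psi charF zp (x + y) = Psi charF zp x * Psi charF zp y.
Proof.
rewrite /Psi absTrD /psi_pi -exprD /= -[RHS](prim_expr_mod zpP).
by congr (_ ^+ (_ %% _)); exact: Fp_cast.
Qed.

Lemma Psi0 : Psi charF zp 0 = 1.
Proof. by rewrite /Psi /absTr !raddf0. Qed.

Lemma Psi_sum (I : Type) (r : seq I) (P : pred I) (f : I -> F) :
  Psi charF zp (\sum_(i <- r | P i) f i) = \prod_(i <- r | P i) Psi charF zp (f i).
Proof. by apply: (big_morph _ PsiD Psi0). Qed.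

Lemma Psi_frob x : Psi charF zp (x ^+ p) = Psi charF zp x.
Proof. by rewrite /Psi absTr_frob. Qed.

(** Translation by an element of nonzero trace multiplies the sum by a value of [Psi] other than
    1. *)
Lemma sum_Psi : \sum_x Psi charF zp x = 0.
Proof.
have [x x0] := absTr_neq0.
have Px : Psi charF zp x != 1.
  rewrite /Psi /psi_pi -(prim_order_dvd zpP); apply/negP => dvd; case/eqP: x0.
  apply: natr_Fp_inj; transitivity (0%R : F) => //; apply/eqP.
  by rewrite -(dvdn_pcharf charF).
apply/eqP; have /eqP : \sum_y Psi charF zp y = Psi charF zp x * \sum_y Psi charF zp y.
  rewrite mulr_sumr [LHS](reindex_inj (addrI x)) /=.
  by apply: eq_bigr => y _; rewrite PsiD.
rewrite -subr_eq0 -{1}[\sum_y _]mul1r -mulrBl mulf_eq0 subr_eq0 eq_sym.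
by rewrite (negPf Px).
Qed.

End Trace.

(** * Base-[p] digits: their sum and the product of their factorials *)

Section Digits.
Variable p : nat.
Hypothesis p_gt1 : (1 < p)%N.
Local Open Scope nat_scope.

Definition digit_sum b m := \sum_(k < b) (m %/ p ^ k) %% p.
Definition digit_fact b m := \prod_(k < b) ((m %/ p ^ k) %% p)`!.

Lemma digit_sum_recl b m : digit_sum b.+1 m = m %% p + digit_sum b (m %/ p).
Proof.
rewrite /digit_sum big_ord_recl divn1; congr addn; apply: eq_bigr => k _.
by rewrite expnS divnMA.
Qed.
Lemma digit_fact_recl b m : digit_fact b.+1 m = (m %% p)`! * digit_fact b (m %/ p).
Proof.
rewrite /digit_fact big_ord_recl divn1; congr muln; apply: eq_bigr => k _.
by rewrite expnS divnMA.
Qed.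
Lemma digit_sum_small b m : m < p ^ b -> digit_sum b.+1 m = digit_sum b m.
Proof. by move=> mb; rewrite /digit_sum big_ord_recr /= divn_small // mod0n addn0. Qed.
Lemma digit_fact_small b m : m < p ^ b -> digit_fact b.+1 m = digit_fact b m.
Proof. by move=> mb; rewrite /digit_fact big_ord_recr /= divn_small // mod0n muln1. Qed.

(** Multiplication by [p] shifts the digits by one place, and the bound ensures that none is pushed
    out. *)
Lemma digit_sumMp b m : p * m < p ^ b -> digit_sum b (p * m) = digit_sum b m.
Proof.
case: b => [|b] pm; first by rewrite /digit_sum !big_ord0.
rewrite digit_sum_recl modnMr mulKn ?(ltnW p_gt1) // digit_sum_small //.
by move: pm; rewrite expnS ltn_pmul2l // ltnW.
Qed.
Lemma digit_factMp b m : p * m < p ^ b -> digit_fact b (p * m) = digit_fact b m.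
Proof.
case: b => [|b] pm; first by rewrite /digit_fact !big_ord0.
rewrite digit_fact_recl modnMr mulKn ?(ltnW p_gt1) // digit_fact_small ?mul1n //.
by move: pm; rewrite expnS ltn_pmul2l // ltnW.
Qed.

Lemma modnS_ndvd m : ~~ (p %| m.+1) -> m.+1 %% p = (m %% p).+1.
Proof. by move=> ndvd; rewrite modnS (negPf ndvd). Qed.
Lemma divnS_ndvd m : ~~ (p %| m.+1) -> m.+1 %/ p = m %/ p.
Proof. by move=> ndvd; rewrite divnS ?(negPf ndvd) // ltnW. Qed.

(** No carry occurs, so only the lowest digit changes. *)
Lemma digit_sumS b m : ~~ (p %| m.+1) -> digit_sum b.+1 m.+1 = (digit_sum b.+1 m).+1.
Proof. by move=> ndvd; rewrite !digit_sum_recl modnS_ndvd // divnS_ndvd // addSn. Qed.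
Lemma digit_factS b m : ~~ (p %| m.+1) ->
  digit_fact b.+1 m.+1 = m.+1 %% p * digit_fact b.+1 m.
Proof.
by move=> ndvd; rewrite !digit_fact_recl modnS_ndvd // divnS_ndvd // factS mulnA.
Qed.

(** All [b] digits of [p ^ b - 1] equal [p - 1]. *)
Lemma digit_sum_max b : digit_sum b (p ^ b).-1 = b * p.-1.
Proof.
elim: b => [|b IHb]; first by rewrite /digit_sum big_ord0.
have E : (p ^ b.+1).-1 = (p ^ b).-1 * p + p.-1.
  by have := expn_gt0 p b; rewrite (ltnW p_gt1) /= expnS; nia.
rewrite digit_sum_recl E modnMDl divnMDl ?(ltnW p_gt1) //
  modn_small ?divn_small ?addn0 ?IHb //; lia.
Qed.
Lemma digit_fact_max b : digit_fact b (p ^ b).-1 = (p.-1)`! ^ b.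
Proof.
elim: b => [|b IHb]; first by rewrite /digit_fact big_ord0.
have E : (p ^ b.+1).-1 = (p ^ b).-1 * p + p.-1.
  by have := expn_gt0 p b; rewrite (ltnW p_gt1) /= expnS; nia.
rewrite digit_fact_recl E modnMDl divnMDl ?(ltnW p_gt1) //
  modn_small ?divn_small ?addn0 ?IHb ?expnS //; lia.
Qed.

End Digits.

(** * Power sums of an injective multiplicative map, for use with the Teichmueller lift and with the
    identity of [F] *)

Section MultiplicativeSums.
Variables (F : finFieldType) (R : fieldType) (chi : F -> R).
Hypotheses (chi1 : chi 1 = 1) (chiM : {morph chi : x y / x * y}).
Hypotheses (chi_inj : injective chi).
Local Notation q1 := (#|F|.-1).

(** A nonzero idempotent [chi 0] would be [1 = chi 1], against injectivity. *)
Lemma chi0 : chi 0 = 0.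
Proof.
apply/eqP/negPn/negP => c0; have := chiM 0 0; rewrite mulr0 -{1}[chi 0]mulr1.
by move/(mulfI c0); rewrite -chi1 => /chi_inj/eqP; rewrite oner_eq0.
Qed.

Lemma chi_eq0 x : (chi x == 0) = (x == 0).
Proof. by rewrite -chi0 (inj_eq chi_inj). Qed.

Lemma chiX x k : chi (x ^+ k) = chi x ^+ k.
Proof. by elim: k => [|k IHk]; rewrite ?expr0 // !exprS chiM IHk. Qed.

Lemma chiV x : chi x^-1 = (chi x)^-1.
Proof.
have [->|x0] := eqVneq x 0; first by rewrite invr0 chi0 invr0.
have cx : chi x != 0 by rewrite chi_eq0.
by apply: (mulfI cx); rewrite divff // -chiM divff.
Qed.

Lemma chi_exprz x (z : int) : chi (x ^ z) = chi x ^ z.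
Proof. by case: z => k; rewrite ?NegzE ?exprzN ?chiV -?exprnP chiX. Qed.

Lemma chi_prod (I : Type) (r : seq I) (P : pred I) (f : I -> F) :
  chi (\prod_(i <- r | P i) f i) = \prod_(i <- r | P i) chi (f i).
Proof. exact: (big_morph chi chiM chi1). Qed.

Lemma chi_card x : x != 0 -> chi x ^+ q1 = 1.
Proof.
move=> x0; rewrite -chiX -chi1; congr chi; apply: (mulfI x0).
by rewrite -exprS prednK ?expf_card ?mulr1 // ltnW // finNzRing_gt1.
Qed.

(** If [q1] does not divide [z], a primitive root [g] has [chi g ^ z != 1], and the substitution of
    [g * x] for [x] multiplies the sum by this factor. *)
Lemma sum_chi (z : int) :
  \sum_(x | x != 0) chi x ^ z = if (q1%:Z %| z)%Z then q1%:R else 0.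
Proof.
case: ifPn => [/dvdzP[c ->]|ndvd].
  under eq_bigr => x x0 do rewrite mulrC -exprz_exp -exprnP chi_card // exp1rz.
  by rewrite sumr_const cardC1.
have [g gP] := fin_field_prim_root F.
have q0 : (0 < q1)%N by rewrite (prim_order_gt0 gP).
have g0 : g != 0.
  apply/eqP => g0; have /eqP := prim_expr_order gP.
  by rewrite g0 expr0n -[q1 == _]negbK -lt0n q0 eq_sym oner_eq0.
have gz : chi g ^ z != 1.
  apply: contra ndvd => /eqP; rewrite {1}(divz_eq z q1) expfzDr ?chi_eq0 //.
  rewrite [(_ %/ _)%Z * _]mulrC -exprz_exp -exprnP chi_card // exp1rz mul1r.
  have: (0 <= z %% q1)%Z by rewrite modz_ge0 //; lia.
  case E: (z %% q1)%Z => [r|//] _; rewrite -exprnP -chiX -chi1 => /chi_inj/eqP.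
  rewrite -(prim_order_dvd gP) => dvd.
  by rewrite (divz_eq z q1) E; apply: rpredD; rewrite ?dvdz_mull //= /dvdz.
set s := \sum_(x | _) _.
have /eqP : s = chi g ^ z * s.
  rewrite {1}/s (reindex_inj (mulfI g0)) mulr_sumr.
  apply: eq_big => [x|x _]; first by rewrite mulf_eq0 (negPf g0).
  by rewrite chiM expfzMl.
rewrite -subr_eq0 -{1}[s]mul1r -mulrBl mulf_eq0 subr_eq0 eq_sym (negPf gz) /=.
by move/eqP.
Qed.

End MultiplicativeSums.

(** * The Teichmueller lift on all of [F] *)

Lemma dvdz_small (d : nat) (z : int) : z != 0 -> (`|z| < d)%N -> (d%:Z %| z)%Z = false.
Proof. by move=> z0 zd; rewrite dvdzE gtnNdvd // absz_gt0. Qed.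

Section GaussSums.
Variables (p a : nat) (pr : prime p) (F : finFieldType).
Hypothesis cardF : #|F| = (p ^ a)%N.
Variable charF : p \in [pchar F].
Variables (K : fieldExtType (padic_field pr)) (ord : K -> \bar rat).
Hypothesis ordP : is_ordp ord.
Variables (pi zp : K) (red : K -> F) (omega : F -> K).
Hypotheses (zpP : p.-primitive_root zp) (piP : pi ^+ p.-1 = - p%:R).
Hypotheses (zp_pi : cong ord (pi ^+ 2) zp (1 + pi)).
Hypotheses (redP : residue_map ord pi red) (omegaP : is_teichmuller ord red omega).
Local Notation q := (p ^ a)%N.
Local Notation ld := (lead ord pi red).
Local Notation Psi := (Psi charF zp).

(** Extension by zero makes the character multiplicative and injective on the whole of [F], as the
    results on power sums require. *)
Definition teich (x : F) : K := if x == 0 then 0 else omega x.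

Lemma teich0 : teich 0 = 0. Proof. by rewrite /teich eqxx. Qed.

Lemma teich_neq0 x : x != 0 -> teich x = omega x.
Proof. by move=> /negPf x0; rewrite /teich x0. Qed.

Lemma teich_is1 : teich 1 = 1.
Proof. by rewrite teich_neq0 ?oner_neq0 // (teich1 omegaP). Qed.

Lemma teich_mul : {morph teich : x y / x * y}.
Proof.
move=> x y; rewrite /teich mulf_eq0.
have [->|x0] := eqVneq x 0; first by rewrite /= mul0r.
have [->|y0] := eqVneq y 0; first by rewrite /= mulr0.
by rewrite (teichM omegaP).
Qed.

Lemma lead_teich x : ld 0 (teich x) x.
Proof.
rewrite /teich; have [->|x0] := eqVneq x 0; first exact: (lead0 ordP redP).
by rewrite /lead expr0 invr1 mul1r (teich_red omegaP) //; split=> //;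
  exact: (teich_int omegaP).
Qed.

Lemma teich_inj : injective teich.
Proof. by move=> x y exy; have [_ <-] := lead_teich x; have [_ <-] := lead_teich y;
  rewrite exy. Qed.

Lemma a_gt0 : (0 < a)%N.
Proof. by case: a cardF => // cF; have := finNzRing_gt1 F; rewrite cF. Qed.

Lemma q_gt1 : (1 < q)%N. Proof. by rewrite -cardF finNzRing_gt1. Qed.

Lemma natr_q1 : q.-1%:R = -1 :> F.
Proof.
apply/eqP; rewrite -addr_eq0 natr1 prednK ?(ltnW q_gt1) //.
by rewrite -(dvdn_pcharf charF) dvdn_exp // a_gt0.
Qed.

Lemma lead_q1 : ld 0 q.-1%:R (-1).
Proof. by rewrite -natr_q1; exact: (lead_nat ordP redP). Qed.

Lemma q1_neq0 : q.-1%:R != 0 :> K.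
Proof.
apply/eqP => q0; have [_] := lead_q1; rewrite q0 mulr0 (red0 ordP redP) => /eqP.
by rewrite eq_sym oppr_eq0 oner_eq0.
Qed.

Lemma pred_card : #|F|.-1 = q.-1. Proof. by rewrite cardF. Qed.

Lemma sum_teich (z : int) :
  \sum_(x | x != 0) teich x ^ z = if (q.-1%:Z %| z)%Z then q.-1%:R else 0.
Proof. by rewrite -pred_card (sum_chi teich_is1 teich_mul teich_inj). Qed.

Lemma sum_exprz (z : int) :
  \sum_(x : F | x != 0) x ^ z = if (q.-1%:Z %| z)%Z then -1 else 0.
Proof. by rewrite (@sum_chi F F id) ?cardF ?natr_q1 //. Qed.

(** * Gauss sums and the expansion of [Psi] *)

Definition gauss m : K := \sum_(x | x != 0) (teich x ^+ m)^-1 * Psi x.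

(* [teich x ^+ q.-1] and [1] agree except at [x = 0], where [Psi] is [1]: this
   is what splits the trivial Fourier coefficient between [m = 0] and
   [m = q.-1]. *)
Definition dwork m : K :=
  if m == 0%N then 1 else
  if m == q.-1 then gauss 0 / q.-1%:R - 1 else gauss m / q.-1%:R.

(** Fourier inversion: after exchanging the sums, the coefficient of [Psi y] is a geometric sum in
    [teich x / teich y], which vanishes unless [y = x]. *)
Lemma gauss_inversion x : x != 0 ->
  \sum_(m < q.-1) gauss m * teich x ^+ m = q.-1%:R * Psi x.
Proof.
move=> x0; under eq_bigr do rewrite /gauss mulr_suml.
rewrite exchange_big /= (bigD1 x) //= [X in _ + X]big1 ?addr0 => [|y /andP[y0 yx]].
  under eq_bigr => m _.
    rewrite mulrAC mulVf ?mul1r; last by rewrite expf_neq0 //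
      (chi_eq0 teich_is1 teich_mul teich_inj).
    over.
  by rewrite sumr_const card_ord mulr_natl.
have ty : teich y != 0 by rewrite (chi_eq0 teich_is1 teich_mul teich_inj).
under eq_bigr do rewrite mulrAC mulrC [_^-1 * _]mulrC -expr_div_n.
rewrite -mulr_sumr; apply/eqP; rewrite mulf_eq0; apply/orP; right.
have z1 : teich x / teich y - 1 != 0.
  rewrite subr_eq0; apply: contra yx => /eqP E; rewrite eq_sym; apply/eqP/teich_inj.
  by rewrite -[teich y]mul1r -E divfK.
rewrite -(inj_eq (mulfI z1)) mulr0 -subrX1 expr_div_n -pred_card.
by rewrite !(chi_card teich_is1 teich_mul) // divr1 subrr.
Qed.

(** At 0 only [m = 0] survives. At [x != 0] the two extreme terms add up to [gauss 0 / q.-1%:R], and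
    what results is Fourier inversion. *)
Lemma Psi_expansion x : Psi x = \sum_(m < q) dwork m * teich x ^+ m.
Proof.
have [q2 Eq] : exists q2, q = q2.+2 by exists q.-2; have := q_gt1; lia.
have [->|x0] := eqVneq x 0.
  rewrite Psi0 teich0 Eq big_ord_recl expr0 mulr1 /dwork eqxx big1 ?addr0 // => i _.
  by rewrite /= exprS mul0r mulr0.
apply: (mulfI q1_neq0); rewrite -gauss_inversion //.
have tq : teich x ^+ q.-1 = 1 by rewrite -pred_card (chi_card teich_is1 teich_mul).
have Q0 := q1_neq0; set Q : K := q.-1%:R in Q0 *.
rewrite [in RHS]Eq [in RHS]big_ord_recl [in RHS]big_ord_recr /=.
rewrite [in LHS]Eq /= big_ord_recl !expr0 !mulr1.
have -> : teich x ^+ lift ord0 (ord_max : 'I_q2.+1) = 1.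
  by rewrite -{}tq Eq.
have -> : dwork (lift ord0 (ord_max : 'I_q2.+1)) = gauss 0 / Q - 1.
  by rewrite /dwork /= /bump /= add1n ifT // Eq.
rewrite {1}/dwork eqxx /=; set S2 := (X in 1 + (X + _)).
rewrite [X in _ = _ * X](_ : _ = gauss 0 / Q + S2); last by ring.
rewrite mulrDr [_ * (_ / _)]mulrC divfK // /S2.
congr (_ + _); rewrite mulr_sumr; apply: eq_bigr => i _.
rewrite /dwork /= /bump /= !add1n ifF //; last by rewrite Eq /=; have := ltn_ord i; lia.
by rewrite -/Q mulrA [Q * _]mulrC divfK.
Qed.

Lemma gauss0 : gauss 0 = -1.
Proof.
rewrite /gauss; under eq_bigr do rewrite expr0 invr1 mul1r.
apply/eqP;
  rewrite -addr_eq0 -[X in _ == X](sum_Psi pr cardF charF zpP) [X in _ == X](bigD1 0) //=.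
by rewrite Psi0 addrC.
Qed.

Lemma gauss_pos m : (0 < m)%N -> gauss m = \sum_x (teich x ^+ m)^-1 * Psi x.
Proof.
by move=> m0; rewrite [RHS](bigD1 0) //= teich0 expr0n eqn0Ngt m0 invr0 mul0r add0r.
Qed.

(** Substitute [x ^+ p] for [x]: Frobenius is injective and [Psi] is invariant under it. *)
Lemma gauss_frob m : gauss (p * m) = gauss m.
Proof.
have injp : injective (fun x : F => x ^+ p).
  by move=> x y; exact: (fmorph_inj (pFrobenius_aut charF)).
rewrite /gauss [RHS](reindex_inj injp) /=; apply: eq_big => [x|x _].
  by rewrite expf_eq0 prime_gt0.
by rewrite (chiX teich_is1 teich_mul) -exprM (Psi_frob pr cardF).
Qed.

(** * Leading terms of Gauss and Jacobi sums *)

Lemma lead_zp1 : ld 1 (zp - 1) 1.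
Proof.
have [z zi ->] := zp_pi; rewrite /lead expr1.
have -> : pi^-1 * (1 + pi + pi ^+ 2 * z - 1) = 1 + pi * z.
  by field; exact: (pi_neq0 ordP piP).
have pzi : integers ord (pi * z) by apply: (integersM ordP) => //;
  exact: (int_pi ordP piP).
split; first by apply: (integersD ordP) => //; exact: (integers1 ordP).
rewrite (red_D redP) //; last exact: (integers1 ordP).
by rewrite (red_1 redP) (red_pi_mul ordP redP piP) // addr0.
Qed.

Lemma lead_zp : ld 0 zp 1.
Proof.
rewrite -(subrK 1 zp) -[X in ld _ _ X]add0r; apply: (leadD ordP redP) => //;
  last exact: (lead1 ordP redP).
exact: (lead_lt ordP redP piP) lead_zp1.
Qed.

(** With [t] the trace of [x], [zp ^+ t - 1] is [zp - 1] times a sum of [t] powers of [zp], each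
    congruent to 1. *)
Lemma lead_Psi1 x : ld 1 (Psi x - 1) (absTr charF x)%:R.
Proof.
rewrite /Defs.Psi /psi_pi subrX1 -[X in ld _ _ X]mul1r -[1%N]addn0.
apply: (leadM ordP redP) => //; first exact: lead_zp1.
set m := nat_of_ord _; rewrite -[in X in ld _ _ X](card_ord m) -sumr_const;
  apply: (lead_sum ordP redP) => // i _.
by rewrite -(expr1n _ i) -[0%N](muln0 i); apply: (leadX ordP redP) => //; exact: lead_zp.
Qed.

Lemma lead_gauss1 : (2 < q)%N -> ld 1 (gauss 1) (-1).
Proof.
move=> q2.
(* As [q > 2], the sum of [(teich x)^-1] is zero, so 1 may be subtracted from [Psi x]; this brings
   out the factor [pi]. *)
have -> : gauss 1 = \sum_(x | x != 0) (teich x)^-1 * (Psi x - 1).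
  under [RHS]eq_bigr do rewrite mulrBr mulr1.
  rewrite sumrB -[LHS]subr0; congr (_ - _); symmetry.
  under eq_bigr do rewrite -exprN1.
  by rewrite sum_teich dvdz_small //; lia.
(* By [absTrE] the sum splits into power sums of exponent [p ^ k - 1], and [q - 1] divides this only
   for [k = 0]. *)
have -> : -1 = \sum_(x : F | x != 0) x^-1 * (absTr charF x)%:R :> F.
  have [b Ea] : exists b, a = b.+1 by exists a.-1; have := a_gt0; lia.
  under eq_bigr => x x0.
    rewrite (absTrE pr cardF) mulr_sumr;
      under eq_bigr do rewrite -exprN1 exprnP -expfzDr //.
    over.
  rewrite exchange_big /= (bigD1 (Ordinal a_gt0)) //= [X in _ + X]big1 ?addr0 => [|k k0].
    by rewrite sum_exprz expn0 addNr dvdz0.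
  have k1 : (p ^ 1 <= p ^ k)%N by rewrite leq_exp2l ?prime_gt1 // lt0n.
  have k2 : (p ^ k < q)%N by rewrite ltn_exp2l ?prime_gt1.
  have := prime_gt1 pr; rewrite expn1 in k1; move: k1 k2 q2.
  by rewrite sum_exprz; move: (p ^ k)%N q => P Q *; rewrite dvdz_small //; lia.
apply: (lead_sum ordP redP) => // x x0; rewrite -[1%N]add0n;
  apply: (leadM ordP redP) => //; last exact: lead_Psi1.
by rewrite -(chiV teich_is1 teich_mul teich_inj); exact: lead_teich.
Qed.

(** The Jacobi sum of [T^-1] and [T^-m]. As the inverse of 0 is 0, the terms at [x = 0] and, for
    [m > 0], at [x = 1] vanish. *)
Definition jacobi m : K := \sum_x (teich x)^-1 * (teich (1 - x) ^+ m)^-1.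

(** The double sum for the product is grouped by the total [r] of the two arguments, and rescaling
    by [r] leaves a Jacobi sum. *)
Lemma gauss_jacobi m : (0 < m)%N -> (m.+1 < q.-1)%N ->
  jacobi m * gauss m.+1 = gauss 1 * gauss m.
Proof.
move=> m0 mq; rewrite !gauss_pos // [RHS]mulr_suml.
under [RHS]eq_bigr => x _.
  rewrite mulr_sumr (reindex_inj (subIr x)) /=; under eq_bigr => y _.
    rewrite mulrACA -PsiD // [x + _]addrC subrK; over.
  over.
rewrite exchange_big /= mulr_sumr; apply: eq_bigr => r _.
rewrite -mulr_suml mulrA; congr (_ * _).
(* For [r = 0] there remains a multiple of the sum of [T^-(m+1)], a nontrivial character since
   [m + 1 < q - 1]. *)
have [->|r0] := eqVneq r 0.
  rewrite teich0 expr0n /= invr0 mulr0; symmetry.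
  under eq_bigr => s _.
    rewrite sub0r -mulN1r teich_mul exprMn invfM expr1 mulrCA -invfM -exprS; over.
  rewrite -mulr_sumr (bigD1 0) //= teich0 expr0n invr0 add0r.
  under eq_bigr do rewrite exprnN.
  by rewrite sum_teich dvdz_small ?mulr0 //; lia.
rewrite [RHS](reindex_inj (mulfI r0)) /jacobi mulr_suml; apply: eq_bigr => s _.
rewrite (_ : r - r * s = r * (1 - s)); last by ring.
rewrite !teich_mul !exprMn !invfM !expr1 exprS invfM; ring.
Qed.

(** Modulo [pi], [(1 - x)^-m] is [(1 - x)^(q-1-m)]. In its binomial expansion only the linear term,
    of coefficient [-(q-1-m)], pairs with [x^-1] to give a nonzero power sum, namely -1; the result
    is [q-1-m = -(m+1)]. *)
Lemma lead_jacobi m : (0 < m)%N -> (m.+1 < q.-1)%N -> ld 0 (jacobi m) (- m.+1%:R).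
Proof.
move=> m0 mq.
have -> : - m.+1%:R = \sum_(x : F) x^-1 * ((1 - x) ^+ m)^-1 :> F.
  have E (x : F) : ((1 - x) ^+ m)^-1 = (1 - x) ^+ (q.-1 - m).
    have [->|y0] := eqVneq (1 - x) 0; first by rewrite !expr0n !gtn_eqF ?invr0 //; lia.
    have y0m : (1 - x) ^+ m != 0 by rewrite expf_neq0.
    apply: (mulfI y0m); rewrite divff // -exprD subnKC; last by lia.
    by rewrite -pred_card (@chi_card F F id).
  under [RHS]eq_bigr => x _.
    rewrite E exprDn mulr_sumr.
    under eq_bigr do rewrite expr1n mul1r -mulN1r exprMn -mulr_natr !mulrA mulrC
      [_^-1 * _]mulrC !mulrA -mulrA.
    over.
  rewrite exchange_big /=.
  under [RHS]eq_bigr => i _.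
    rewrite -mulr_sumr (bigD1 0) //= invr0 mul0r add0r.
    under eq_bigr => x x0 do rewrite -exprN1 exprnP -expfzDr //.
    rewrite sum_exprz; over.
  have i1 : (1 < (q.-1 - m).+1)%N by lia.
  rewrite (bigD1 (Ordinal i1)) //= big1 ?addr0 => [|i ni].
    rewrite addNr dvdz0 bin1 expr1 natrB ?natr_q1; last by lia.
    by rewrite -natr1; ring.
  have : (i <> 1 :> nat)%N by move=> i1'; case/eqP: ni; apply: val_inj.
  move=> i1'; have := ltn_ord i; move: mq i1'.
  move: (nat_of_ord i) => j; move: {i ni i1} (p ^ a)%N => Q *.
  by rewrite dvdz_small ?mulr0 //; lia.
apply: (lead_sum ordP redP) => // x _; rewrite -[0%N]addn0;
  apply: (leadM ordP redP) => //.
  by rewrite -(chiV teich_is1 teich_mul teich_inj); exact: lead_teich.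
by rewrite -(chiX teich_is1 teich_mul) -(chiV teich_is1 teich_mul teich_inj) -exprVn
  (chiX teich_is1 teich_mul)
   -[0%N](muln0 m); apply: (leadX ordP redP) => //; exact: lead_teich.
Qed.

(** * Stickelberger's congruence for the coefficients [dwork m] *)

Lemma lead_dwork1 : (2 < q)%N -> ld 1 (dwork 1) 1.
Proof.
move=> q2; rewrite /dwork /= ifF; last by apply/negbTE; lia.
rewrite -[1 in X in ld _ _ X](mulVf (x := (-1 : F))) ?oppr_eq0 ?oner_neq0 //.
apply: (lead_div ordP redP piP) lead_q1 _; first by rewrite oppr_eq0 oner_neq0.
by rewrite mulrC divfK ?q1_neq0 //; exact: lead_gauss1.
Qed.

Lemma natr_fact_pred : (p.-1)`!%:R = -1 :> F.
Proof.
apply/eqP; rewrite -addr_eq0 natr1 -(dvdn_pcharf charF).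
by rewrite -Wilson ?prime_gt1.
Qed.

(** Since [gauss 0 = -1], this coefficient is [-q / (q - 1)], and [q = (- pi ^+ p.-1) ^+ a]. *)
Lemma lead_dwork_max : ld (a * p.-1) (dwork q.-1) ((-1) ^+ a).
Proof.
have q1 := q_gt1.
rewrite /dwork ifF; last by apply/negbTE; lia.
rewrite eqxx gauss0.
have -> : (-1) ^+ a = (-1)^-1 * (-1 * (-1) ^+ a) :> F.
  by rewrite invrN1 mulrA mulrNN mulr1 mul1r.
apply: (lead_div ordP redP piP) lead_q1 _; first by rewrite oppr_eq0 oner_neq0.
have -> : q.-1%:R * (-1 / q.-1%:R - 1) = - (- (pi ^+ p.-1)) ^+ a :> K.
  rewrite piP opprK -natrX mulrBr mulrCA divff ?q1_neq0 // !mulr1.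
  by rewrite -opprD addrC natr1 prednK // ltnW.
rewrite mulN1r; apply: (leadN ordP redP); apply: (leadX ordP redP).
by apply: (leadN ordP redP); exact: (lead_pi ordP redP piP).
Qed.

Lemma lead_dwork m : (m < q)%N ->
  ld (digit_sum p a m) (dwork m) (digit_fact p a m)%:R^-1.
Proof.
have p1 := prime_gt1 pr; have q1 := q_gt1.
elim/ltn_ind: m => m IHm mq.
have [->|m0] := posnP m.
  rewrite /digit_sum /digit_fact big1 => [|k _]; last by rewrite div0n mod0n.
  rewrite big1 => [|k _]; last by rewrite div0n mod0n.
  by rewrite invr1; exact: (lead1 ordP redP).
have [->|mq1] := eqVneq m q.-1.
  (* Wilson's theorem turns the inverse factorials into powers of -1. *)
  rewrite digit_sum_max // digit_fact_max // natrX natr_fact_pred -exprVn invrN1.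
  exact: lead_dwork_max.
have mltq1 : (m < q.-1)%N by move/eqP: mq1; lia.
have [b Ea] : exists b, a = b.+1 by exists a.-1; have := a_gt0; lia.
have dworkE k : (0 < k)%N -> (k < q.-1)%N -> dwork k = gauss k / q.-1%:R.
  by move=> k0 kq; rewrite /dwork !ifF //; apply/negbTE; lia.
have [/dvdnP[k Em]|ndvd] := boolP (p %| m)%N.
  have {}Em : m = (p * k)%N by rewrite Em mulnC.
  have k0 : (0 < k)%N by move: m0; rewrite Em; case: k {Em}; rewrite ?muln0.
  have km : (k < m)%N by rewrite Em ltn_Pmull.
  rewrite dworkE // Em gauss_frob -dworkE //; last by exact: ltn_trans mltq1.
  have pkq : (p * k < q)%N by rewrite -Em.
  rewrite digit_sumMp // digit_factMp //.
  by apply: IHm => //; exact: ltn_trans mq.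
case: m m0 IHm mq mq1 mltq1 ndvd => // m _ IHm mq _ mltq1 ndvd.
(* The index is now [m.+1]. Index 1 is treated directly; it is below [q - 1], so [q > 2]. *)
have [m0|m0] := posnP m.
  rewrite m0 in ndvd *.
  have ds1 : digit_sum p a 1 = 1%N.
    rewrite Ea digit_sumS // /digit_sum big1 // => k _.
    by rewrite div0n mod0n.
  have df1 : digit_fact p a 1 = 1%N.
    rewrite Ea digit_factS // modn_small // mul1n /digit_fact big1 // => k _.
    by rewrite div0n mod0n.
  by rewrite ds1 df1 invr1; apply: lead_dwork1; lia.
have m1 : m.+1%:R != 0 :> F by rewrite -(dvdn_pcharf charF).
(* Only the last digit changes from [m] to [m.+1], and in [F] it equals [m.+1], the negative of the
   leading term of the Jacobi sum. *)
have -> : (digit_fact p a m.+1)%:R^-1 =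
    (- m.+1%:R)^-1 * (-1 * (1 * (digit_fact p a m)%:R^-1)) :> F.
  rewrite Ea digit_factS // natrM invfM -Ea invrN mul1r mulN1r mulrNN; congr (_^-1 * _).
  rewrite [in RHS](divn_eq m.+1 p) natrD natrM (pcharf0 charF) mulr0 add0r //.
apply: (lead_div ordP redP piP) (lead_jacobi _ _) _ => //; first by rewrite oppr_eq0.
rewrite Ea digit_sumS // -Ea -[_.+1]add1n -[(1 + _)%N]add0n.
have -> : jacobi m * dwork m.+1 = q.-1%:R * (dwork 1 * dwork m).
  rewrite !dworkE //; try lia.
  rewrite mulrA gauss_jacobi //.
  by field; exact: q1_neq0.
apply: (leadM ordP redP); first exact: lead_q1.
apply: (leadM ordP redP); first by apply: lead_dwork1; lia.
by apply: IHm => //; exact: ltn_trans mq.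
Qed.

End GaussSums.

(** * Expansion of the exponential sum over [U_M] *)

Lemma sum_units_prod (R : comNzRingType) (F : finFieldType) n (f : 'I_n -> F -> R) :
  \sum_(x : {ffun 'I_n -> F} | [forall i, x i != 0]) \prod_i f i (x i) =
  \prod_i \sum_(t | t != 0) f i t.
Proof.
rewrite bigA_distr_big; apply: eq_bigl => x.
by apply/forallP/ffun_onP => x0 i; move: (x0 i); rewrite ?inE.
Qed.

Lemma expfz_sum (R : fieldType) (x : R) (I : Type) (r : seq I) (P : pred I)
    (z : I -> int) :
  x != 0 -> x ^ (\sum_(i <- r | P i) z i) = \prod_(i <- r | P i) x ^ z i.
Proof.
move=> x0; apply: (big_rec2 (fun u v => x ^ u = v)) => [|i v u _ <-].
  exact: expr0z.
exact: expfzDr.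
Qed.

Section ExponentialSum.
Variables (p a n N : nat) (pr : prime p) (F : finFieldType).
Hypothesis cardF : #|F| = (p ^ a)%N.
Variable charF : p \in [pchar F].
Variables (K : fieldExtType (padic_field pr)) (ord : K -> \bar rat).
Hypothesis ordP : is_ordp ord.
Variables (pi zp : K) (red : K -> F) (omega : F -> K).
Hypotheses (zpP : p.-primitive_root zp) (piP : pi ^+ p.-1 = - p%:R).
Hypotheses (zp_pi : cong ord (pi ^+ 2) zp (1 + pi)).
Hypotheses (redP : residue_map ord pi red) (omegaP : is_teichmuller ord red omega).
Variables (A : 'I_N -> 'rV[int]_n) (e : 'rV[int]_n) (lam : 'I_N -> F).
Local Notation q := (p ^ a)%N.
Local Notation ld := (lead ord pi red).
Local Notation T := (teich omega).
Local Notation C := (dwork a charF zp omega).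
Local Notation M := (latticeM p a e).
Let T1 := teich_is1 omegaP.
Let TM := teich_mul omegaP.
Let Tinj := teich_inj ordP redP omegaP.

(** Membership in [M], read coordinatewise, is the condition under which the power sums over each
    [x i] do not vanish. *)
Lemma UM_dvd (u : {ffun 'I_N -> 'I_q}) : reflect (@UM p a n N A M u)
  [forall i, (q.-1%:Z %| - e 0%R i + \sum_j A j 0%R i *+ u j)%Z].
Proof.
have coordE i : (\sum_j A j *+ u j) 0 i = \sum_j A j 0 i *+ u j.
  by rewrite summxE; apply: eq_bigr => j _; rewrite mulmxnE.
apply: (iffP forallP) => [dvd|[z _ zE] i].
  exists (\row_i ((- e 0%R i + \sum_j A j 0%R i *+ u j) %/ q.-1)%Z) => //.
  apply/rowP => i; rewrite coordE !mxE mulmxnE mxE -mulr_natr natz.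
  by rewrite divzK ?dvd // addNKr.
rewrite -coordE -zE !mxE mulmxnE addKr -mulr_natr natz; exact: dvdz_mull.
Qed.

Lemma expsumE : expsum charF zp omega A e lam =
  q.-1%:R ^+ n * \sum_(u : {ffun 'I_N -> 'I_q} | `[< @UM p a n N A M u >])
    \prod_j (C (u j) * T (lam j) ^+ u j).
Proof.
rewrite /expsum.
transitivity (\sum_(x : {ffun 'I_n -> F} | [forall i, x i != 0])
    \sum_(u : {ffun 'I_N -> 'I_q}) (\prod_j (C (u j) * T (lam j) ^+ u j)) *
     \prod_i T (x i) ^ (- e 0 i + \sum_j A j 0 i *+ u j)).
  apply: eq_bigr => x /forallP x0; rewrite /laurent_eval (Psi_sum pr charF zpP).
  under [X in _ * X]eq_bigr do rewrite (Psi_expansion cardF charF ordP zpP redP omegaP).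
  (* The product over [j] of sums over [m < q] becomes a sum over exponent vectors [u]. *)
  rewrite bigA_distr_bigA mulr_sumr; apply: eq_bigr => u _ /=.
  under [X in _ * X = _]eq_bigr => j _ do
    rewrite TM exprMn (chi_prod T1 TM) -prodrXl mulrA.
  rewrite big_split /= mulrCA; congr (_ * _).
  rewrite exchange_big /= -big_split /=; apply: eq_bigr => i _.
  have Tx : T (x i) != 0 by rewrite (chi_eq0 T1 TM Tinj) x0.
  rewrite expfzDr // -(teich_neq0 omega (x0 i)); congr (_ * _).
  rewrite expfz_sum //.
  apply: eq_bigr => j _.
  by rewrite (chi_exprz T1 TM Tinj) // -mulr_natr natz -exprz_exp.
rewrite exchange_big /= mulr_sumr [RHS]big_mkcond /=; apply: eq_bigr => u _.
(* The sum over [x] factors over the coordinates, each factor being [q - 1] or 0. *)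
rewrite -mulr_sumr (sum_units_prod (fun i t => T t ^ (- e 0 i + \sum_j A j 0 i *+ u j))).
under [X in _ * X = _]eq_bigr do rewrite (sum_teich cardF ordP redP omegaP).
case: ifPn => [/asboolP/UM_dvd/forallP dvd|/asboolPn ndvd].
  under [X in _ * X = _]eq_bigr do rewrite dvd.
  by rewrite [X in _ * X = _]prodr_const card_ord mulrC.
have /forallPn[i ni] : ~~ [forall i, (q.-1%:Z %| - e 0%R i + \sum_j A j 0%R i *+ u j)%Z].
  by apply/negP => /UM_dvd.
by rewrite [X in _ * X](bigD1 i) //= (negPf ni) mul0r mulr0.
Qed.

Lemma wpE (u : {ffun 'I_N -> 'I_q}) : wp u = (\sum_j digit_sum p a (u j))%N.
Proof. by []. Qed.

(** The factor [(q - 1)^n] gives the sign, and every [u] of digit weight above the minimum has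
    leading coefficient 0 at this level. *)
Lemma lead_expsum : ld (wpM p a A M) (expsum charF zp omega A e lam)
  ((-1) ^+ n *
   \sum_(u : {ffun 'I_N -> 'I_q} | `[< @UM p a n N A M u >] && (wp u == wpM p a A M))
     \prod_j ((digit_fact p a (u j))%:R^-1 * lam j ^+ u j)).
Proof.
set w := wpM _ _ _ _; rewrite expsumE -[X in ld X _ _]add0n; apply: (leadM ordP redP).
  rewrite -[0%N](muln0 n); apply: (leadX ordP redP).
  exact: (lead_q1 cardF charF ordP redP).
rewrite [X in ld _ _ X]big_mkcondr; apply: (lead_sum ordP redP) => u /asboolP uM.
have ldu : ld (wp u) (\prod_j (C (u j) * T (lam j) ^+ u j))
    (\prod_j ((digit_fact p a (u j))%:R^-1 * lam j ^+ u j)).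
  rewrite wpE; apply: (lead_prod ordP redP) => j _; rewrite -[digit_sum _ _ _]addn0.
  apply: (leadM ordP redP).
    exact: (lead_dwork cardF charF ordP zpP piP zp_pi redP omegaP).
  by rewrite -[0%N](muln0 (u j)); apply: (leadX ordP redP);
    exact: (lead_teich ordP redP omegaP).
have [uw|uw] := eqVneq (wp u) w; first by rewrite -{1}uw.
apply: (lead_lt ordP redP piP) ldu; rewrite ltn_neqAle eq_sym uw.
have wu : [set wp u | u in @UM p a n N A M] (wp u) by exists u.
by have [_] := min_natP (ex_intro _ _ wu); apply.
Qed.

End ExponentialSum.

(** * Exponent vectors as sequences of digit vectors *)

Section DigitVectors.
Variable p : nat.
Hypothesis p_gt1 : (1 < p)%N.
Local Open Scope nat_scope.
Let p_gt0 : 0 < p. Proof. exact: ltnW. Qed.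

Lemma base_recl b (d : nat -> nat) :
  \sum_(k < b.+1) d k * p ^ k = (\sum_(k < b) d k.+1 * p ^ k) * p + d 0.
Proof.
rewrite big_ord_recl muln1 addnC big_distrl; congr addn; apply: eq_bigr => k _.
by rewrite /= /bump add1n expnSr mulnA.
Qed.

Lemma base_small b (d : nat -> nat) : (forall k, d k < p) ->
  \sum_(k < b) d k * p ^ k < p ^ b.
Proof.
elim: b d => [|b IHb] d dp; first by rewrite big_ord0.
have := IHb (fun k => d k.+1) (fun k => dp k.+1); have := dp 0.
by rewrite base_recl expnS; nia.
Qed.

Lemma base_digit b (d : nat -> nat) l : (forall k, d k < p) -> l < b ->
  (\sum_(k < b) d k * p ^ k) %/ p ^ l %% p = d l.
Proof.
elim: b d l => [//|b IHb] d [|l] dp lb; rewrite base_recl.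
  by rewrite divn1 modnMDl modn_small.
by rewrite expnS divnMA divnMDl // [d 0 %/ p]divn_small // addn0 (IHb (fun k => d k.+1)).
Qed.

Lemma digit_base b m : m < p ^ b -> \sum_(k < b) (m %/ p ^ k) %% p * p ^ k = m.
Proof.
elim: b m => [|b IHb] m mb; first by rewrite big_ord0; case: m mb.
rewrite (base_recl b (fun k => (m %/ p ^ k) %% p)) divn1.
under eq_bigr do rewrite expnS divnMA.
rewrite IHb -?divn_eq // ltn_divLR // mulnC -expnS //.
Qed.

Lemma ord_base_small b (d : 'I_b -> 'I_p) : \sum_(k < b) d k * p ^ k < p ^ b.
Proof.
case: b d => [|b] d; first by rewrite big_ord0.
(* The digits are extended to all natural indices through [inord], so that the recursion on the
   number of places applies. *)
have -> : \sum_(k < b.+1) d k * p ^ k = \sum_(k < b.+1) d (inord k) * p ^ k.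
  by apply: eq_bigr => k _; rewrite inord_val.
exact: (@base_small b.+1 (fun k => d (inord k))).
Qed.

Lemma ord_base_digit b (d : 'I_b -> 'I_p) (l : 'I_b) :
  (\sum_(k < b) d k * p ^ k) %/ p ^ l %% p = d l.
Proof.
case: b d l => [|b] d l; first by case: l.
have -> : \sum_(k < b.+1) d k * p ^ k = \sum_(k < b.+1) d (inord k) * p ^ k.
  by apply: eq_bigr => k _; rewrite inord_val.
by rewrite (@base_digit b.+1 (fun k => d (inord k))) // inord_val.
Qed.

Variables a N : nat.

(** With inverse [digits], it reindexes sums over exponent vectors by [a] rows of digits. *)
Definition assemble (d : {ffun 'I_a -> {ffun 'I_N -> 'I_p}}) :
    {ffun 'I_N -> 'I_(p ^ a)} :=
  [ffun j => Ordinal (ord_base_small (fun k => d k j))].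

Definition digits (u : {ffun 'I_N -> 'I_(p ^ a)}) : {ffun 'I_a -> {ffun 'I_N -> 'I_p}} :=
  [ffun k : 'I_a => [ffun j => Ordinal (ltn_pmod (u j %/ p ^ k) p_gt0)]].

Lemma assembleE d j : assemble d j = \sum_(k < a) d k j * p ^ k :> nat.
Proof. by rewrite ffunE. Qed.

Lemma assembleK : cancel assemble digits.
Proof.
move=> d; apply/ffunP => k; apply/ffunP => j; apply: val_inj; rewrite !ffunE /=.
by rewrite (ord_base_digit (fun k => d k j)).
Qed.

Lemma digitsK : cancel digits assemble.
Proof.
move=> u; apply/ffunP => j; apply: val_inj; rewrite /= assembleE.
under eq_bigr do rewrite !ffunE /=.
exact: digit_base.
Qed.

Lemma assemble_bij : bijective assemble.
Proof. by exists digits; [exact: assembleK|exact: digitsK]. Qed.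

Lemma digit_sum_assemble d j : digit_sum p a (assemble d j) = \sum_(k < a) d k j.
Proof. by apply: eq_bigr => k _; rewrite assembleE (ord_base_digit (fun k => d k j)). Qed.

Lemma digit_fact_assemble d j : digit_fact p a (assemble d j) = \prod_(k < a) (d k j)`!.
Proof. by apply: eq_bigr => k _; rewrite assembleE (ord_base_digit (fun k => d k j)). Qed.

End DigitVectors.

(** * Carrying modulo [q - 1] and minimality of the digit weight *)

Section Carry.
Variables (p a n N : nat) (A : 'I_N -> 'rV[int]_n) (e : 'rV[int]_n).
Hypothesis p_gt1 : (1 < p)%N.
Local Notation q := (p ^ a)%N.
Local Notation M := (latticeM p a e).
Local Notation w := (wpM p a A M).

(** The entries may be [p] or more, because replacing a row by another representation can leave the
    range of digits. *)
Definition lattice_value (v : 'I_a -> 'I_N -> nat) : 'rV[int]_n :=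
  \sum_k (\sum_j A j *+ v k j) *+ p ^ k.

Lemma lattice_value_assemble (d : {ffun 'I_a -> {ffun 'I_N -> 'I_p}}) :
  \sum_j A j *+ assemble p_gt1 d j = lattice_value (fun k j => d k j).
Proof.
rewrite /lattice_value; under [RHS]eq_bigr do rewrite -sumrMnl.
rewrite exchange_big /=; apply: eq_bigr => j _.
rewrite assembleE -sumrMnr; apply: eq_bigr => k _.
by rewrite mulrnA.
Qed.

Lemma wp_assemble (d : {ffun 'I_a -> {ffun 'I_N -> 'I_p}}) :
  wp (assemble p_gt1 d) = (\sum_(k < a) \sum_j d k j)%N.
Proof.
by rewrite wpE [RHS]exchange_big; apply: eq_bigr => j _; rewrite digit_sum_assemble.
Qed.

Lemma latticeM_sub (x y : 'rV[int]_n) : M x -> M (x - y *+ q.-1).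
Proof. by case=> z _ <-; exists (z - y) => //; rewrite mulrnBl addrA. Qed.

Lemma carry_step (v : 'I_a -> 'I_N -> nat) k0 j0 : (p <= v k0 j0)%N ->
  exists v' : 'I_a -> 'I_N -> nat,
    (M (lattice_value v) -> M (lattice_value v')) /\
    (\sum_k \sum_j v' k j < \sum_k \sum_j v k j)%N.
Proof.
move=> pv; pose at_ (k1 k : 'I_a) (j : 'I_N) : nat := (k == k1) && (j == j0).
(* [ordS] is the cyclic successor, so a carry out of the last place enters place 0. *)
exists (fun k j => v k j - at_ k0 k j * p + at_ (ordS k0) k j)%N.
set v' := fun k j => _.
have vE k j : (v k j + at_ (ordS k0) k j = v' k j + at_ k0 k j * p)%N.
  rewrite /v' addnAC subnK // /at_; case: eqP => [->|//]; case: eqP => [->|//].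
  by rewrite mul1n.
have sum_at k1 : (\sum_k \sum_j at_ k1 k j = 1)%N.
  rewrite (bigD1 k1) //= (bigD1 j0) //= /at_ !eqxx /= !big1 // => [k kk|j jj].
    by rewrite big1 // => j _; rewrite (negPf kk).
  by rewrite (negPf jj) ?andbF.
have val_at k1 c : lattice_value (fun k j => at_ k1 k j * c)%N = A j0 *+ (c * p ^ k1).
  rewrite /lattice_value (bigD1 k1) //= (bigD1 j0) //= /at_ !eqxx /= mul1n !big1.
  - by rewrite !addr0 mulrnA.
  - by move=> k kk; rewrite big1 ?mul0rn // => j _; rewrite (negPf kk) mulr0n.
  - by move=> j jj; rewrite (negPf jj) ?andbF mulr0n.
have valD (v1 v2 : 'I_a -> 'I_N -> nat) :
    lattice_value (fun k j => v1 k j + v2 k j)%N = lattice_value v1 + lattice_value v2.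
  rewrite /lattice_value -big_split /=; apply: eq_bigr => k _.
  by rewrite -mulrnDl -big_split /=; congr (_ *+ _); apply: eq_bigr => j _;
    rewrite mulrnDr.
have eval_ : lattice_value v + A j0 *+ (p ^ ordS k0) = lattice_value v' + A j0 *+ (p *
  p ^ k0).
  rewrite -[(p ^ ordS k0)%N]mul1n -!val_at -!valD; apply: eq_bigr => k _.
  by congr (_ *+ _); apply: eq_bigr => j _; rewrite muln1 vE.
split.
  move=> Mv.
  have -> : lattice_value v' = lattice_value v + A j0 *+ (p ^ ordS k0) - A j0 *+ (p * p ^ k0).
    by rewrite eval_ addrK.
  (* A carry out of the last place subtracts [q - 1] times [A j0], which preserves [M]; any other
     carry keeps the value. *)
  rewrite -expnS /=; have := ltn_ord k0; rewrite leq_eqVlt => /predU1P[ka|ka].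
    rewrite ka modnn expn0 mulr1n -addrA.
    have -> : A j0 - A j0 *+ q = - (A j0 *+ q.-1).
      rewrite -[X in _ - _ *+ X](prednK (n := q)) ?expn_gt0 ?(ltnW p_gt1) //.
      by rewrite mulrS opprD addrA subrr add0r.
    exact: latticeM_sub.
  by rewrite modn_small // addrK.
have : ((\sum_k \sum_j v k j) + 1 = (\sum_k \sum_j v' k j) + p)%N.
  rewrite -{1}(sum_at (ordS k0)) -[in RHS](mul1n p) -(sum_at k0) big_distrl /=.
  rewrite -!big_split /=; apply: eq_bigr => k _; rewrite big_distrl /= -!big_split /=.
  by apply: eq_bigr => j _; rewrite vE.
rewrite -/v'; move: (\sum_k \sum_j v k j)%N (\sum_k \sum_j v' k j)%N => X Y.
by move: p_gt1; lia.
Qed.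

(** Induction on the total. If all entries are digits, they assemble to an element of [U_M];
    otherwise a carry gives a strictly smaller total that is still at least [w]. *)
Lemma carry (v : 'I_a -> 'I_N -> nat) : M (lattice_value v) ->
  (w <= \sum_k \sum_j v k j)%N /\
  ((\sum_k \sum_j v k j)%N = w -> forall k j, (v k j < p)%N).
Proof.
move: {2}_.+1 (ltnSn (\sum_k \sum_j v k j)%N) => s; elim: s v => // s IHs v vs Mv.
have [/forallP small|] := boolP [forall k, forall j, v k j < p]%N.
  have {}small k j : (v k j < p)%N by move/forallP: (small k); apply.
  split=> //.
  pose d := [ffun k => [ffun j => Ordinal (small k j)]]
    : {ffun 'I_a -> {ffun 'I_N -> 'I_p}}.
  have dE k j : d k j = v k j :> nat by rewrite !ffunE.
  have dU : @UM p a n N A M (assemble p_gt1 d).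
    rewrite /UM /= lattice_value_assemble; congr (M _): Mv.
    by apply: eq_bigr => k _; congr (_ *+ _); apply: eq_bigr => j _; rewrite dE.
  have -> : (\sum_k \sum_j v k j)%N = wp (assemble p_gt1 d).
    by rewrite wp_assemble; apply: eq_bigr => k _; apply: eq_bigr => j _; rewrite dE.
  have wu : [set wp u | u in @UM p a n N A M] (wp (assemble p_gt1 d)).
    by exists (assemble p_gt1 d).
  by have [_] := min_natP (ex_intro _ _ wu); apply.
rewrite negb_forall => /existsP[k0]; rewrite negb_forall => /existsP[j0].
rewrite -leqNgt => /carry_step [v' [Mv' lt_v']].
have [] := IHs v' _ (Mv' Mv); first exact: leq_trans lt_v' _.
move=> le_w _; split; first exact: leq_trans le_w (ltnW lt_v').
by move=> E; move: (leq_ltn_trans le_w lt_v'); rewrite E ltnn.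
Qed.

End Carry.

(** * Minimal representations and the polynomials of good elements *)

Section Weights.
Variables (p a n N : nat) (A : 'I_N -> 'rV[int]_n).

Lemma weight_le gamma u : Uplus A gamma u -> (weight A gamma <= mdeg u)%N.
Proof.
move=> uP; have wu : [set mdeg u | u in Uplus A gamma] (mdeg u) by exists u.
by have [_] := min_natP (ex_intro _ _ wu); apply.
Qed.

Lemma Umin_exists gamma : NA A gamma -> exists u, Umin A gamma u.
Proof.
case=> u uP; have wu : [set mdeg u | u in Uplus A gamma] (mdeg u) by exists u.
by have [[v vP vw] _] := min_natP (ex_intro _ _ wu); exists v.
Qed.

Definition mnm_of (v : {ffun 'I_N -> 'I_p}) : 'X_{1..N} := [multinom (v i : nat) | i < N].

Lemma mnm_of_inj : injective mnm_of.
Proof.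
move=> u v /mnmP uv; apply/ffunP => i; apply: val_inj.
by have := uv i; rewrite !mnmE.
Qed.

Lemma mdeg_mnm_of v : mdeg (mnm_of v) = (\sum_j v j)%N.
Proof. by rewrite mdegE; apply: eq_bigr => j _; rewrite mnmE. Qed.

Lemma Uplus_mnm_of gamma v :
  Uplus A gamma (mnm_of v) <-> \sum_j A j *+ v j = gamma.
Proof. by rewrite /Uplus /=; under eq_bigr do rewrite mnmE. Qed.

Lemma mnm_of_surj (u : 'X_{1..N}) : (forall i, (u i < p)%N) -> exists v, u = mnm_of v.
Proof.
move=> up; exists [ffun i => Ordinal (up i)].
by apply/mnmP => i; rewrite mnmE ffunE.
Qed.

Lemma good_Umin gamma u : (0 < p)%N -> good p A gamma -> Umin A gamma u ->
  exists2 v, u = mnm_of v & Umin A gamma (mnm_of v).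
Proof.
move=> p0 g_good uP; have [|v uv] := @mnm_of_surj u.
  by move=> i; have := g_good u uP i; rewrite -ltnS prednK.
by exists v => //; rewrite -uv.
Qed.

(** Goodness bounds the exponents by [p - 1], so the finitely supported sum over all multinomials
    becomes a sum over the finite type of digit vectors. *)
Lemma Fpoly_good gamma : (0 < p)%N -> good p A gamma ->
  Fpoly p A gamma = \sum_(v : {ffun 'I_N -> 'I_p} | `[< Umin A gamma (mnm_of v) >])
     (\prod_i (v i)`!%:R : 'F_p)^-1 *: 'X_[mnm_of v].
Proof.
move=> p0 g_good; rewrite /Fpoly.
pose r := [seq mnm_of v | v <- enum [pred v | `[< Umin A gamma (mnm_of v) >]]].
rewrite (fsbigE r); first last.
- move=> u uP /negP[]; have [v -> vP] := good_Umin p0 g_good uP.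
  by apply: map_f; rewrite mem_enum inE.
- by move=> u /mapP[v]; rewrite mem_enum inE => vP ->.
- by rewrite map_inj_uniq ?enum_uniq //; exact: mnm_of_inj.
rewrite big_map big_enum_cond; apply: eq_big => [v|v _].
  rewrite inE /=; case: asboolP => //= vP; exact/mem_set.
by congr (_^-1 *: _); apply: eq_bigr => i _; rewrite mnmE.
Qed.

End Weights.

(** * Evaluation of the Hasse polynomial *)

Section HasseEvaluation.
Variables (p a n N : nat) (pr : prime p) (F : finFieldType).
Hypothesis cardF : #|F| = (p ^ a)%N.
Variable charF : p \in [pchar F].
Variables (A : 'I_N -> 'rV[int]_n) (e : 'rV[int]_n) (lam : 'I_N -> F).
Local Notation q := (p ^ a)%N.
Local Notation M := (latticeM p a e).
Local Notation w := (wpM p a A M).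
Local Notation ev := (fun P : {mpoly 'F_p[N]} => eval_Fp charF P lam).
Local Notation D := {ffun 'I_a -> {ffun 'I_N -> 'I_p}}.
Let p_gt1 := prime_gt1 pr.
Let p_gt0 := prime_gt0 pr.

Lemma eval_FpD : {morph ev : P Q / P + Q}.
Proof. by move=> P Q; rewrite /eval_Fp !raddfD. Qed.
Lemma eval_FpM : {morph ev : P Q / P * Q}.
Proof. by move=> P Q; rewrite /eval_Fp !rmorphM. Qed.
Lemma eval_Fp1 : ev 1 = 1. Proof. by rewrite /eval_Fp !rmorph1. Qed.
Lemma eval_Fp0 : ev 0 = 0. Proof. by rewrite /eval_Fp !raddf0. Qed.

Lemma in_alg_prod_natV (I : Type) (r : seq I) (f : I -> nat) :
  in_alg (pPrimeCharType charF) (\prod_(i <- r) (f i)%:R)^-1 = \prod_(i <- r) (f i)%:R^-1.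
Proof.
rewrite fmorphV rmorph_prod -prodfV.
by apply: eq_bigr => i _; rewrite rmorph_nat.
Qed.

(** One monomial of [F_gamma], evaluated at [lam] raised to the power [p ^ k]. *)
Definition digit_term (k : nat) (v : {ffun 'I_N -> 'I_p}) : F :=
  \prod_j ((v j)`!%:R^-1 * (lam j ^+ (p ^ k)) ^+ v j).

Lemma eval_Fpoly gamma k : good p A gamma ->
  ev (Fpoly p A gamma \mPo [tuple 'X_i ^+ (p ^ k) | i < N]) =
  \sum_(v : {ffun 'I_N -> 'I_p} | `[< Umin A gamma (mnm_of v) >]) digit_term k v.
Proof.
move=> g_good; rewrite Fpoly_good // raddf_sum (big_morph _ eval_FpD eval_Fp0).
apply: eq_bigr => v _; rewrite /= comp_mpolyZ comp_mpolyX /eval_Fp map_mpolyZ mevalZ.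
rewrite [X in X * _](in_alg_prod_natV _ (fun i =>
  (v i)`!)) !rmorph_prod /digit_term big_split /=; congr (_ * _).
by apply: eq_bigr => i _; rewrite tnth_mktuple mnmE !rmorphXn /= map_mpolyX mevalXU.
Qed.

Definition gammas (d : D) : {ffun 'I_a -> 'rV[int]_n} :=
  [ffun k => \sum_j A j *+ d k j].

Lemma gammas_value d : \sum_k gammas d k *+ p ^ k = lattice_value p A (fun k j => d k j).
Proof. by apply: eq_bigr => k _; rewrite ffunE. Qed.

(** From right to left the row weights add up to [w]. From left to right, rows are exchanged one at
    a time and [carry] is applied. *)
Lemma minimal_digits (d : D) :
  (@UM p a n N A M (assemble p_gt1 d) /\ wp (assemble p_gt1 d) = w) <->
  (@GammaM p a n N A M (gammas d) /\ forall k, Umin A (gammas d k) (mnm_of (d k))).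
Proof.
rewrite /UM /= lattice_value_assemble wp_assemble -gammas_value; split; last first.
  move=> [[_ Mg wg] dmin]; split=> //; rewrite -wg; apply: eq_bigr => k _.
  by have [_ <-] := dmin k; rewrite mdeg_mnm_of.
move=> [Mg wd].
have dplus k : Uplus A (gammas d k) (mnm_of (d k)) by apply/Uplus_mnm_of; rewrite ffunE.
(* Replacing row [k0] by another representation [u] of the same point keeps the value in [M]. The
   bound of [carry] gives minimality of the row, and its equality case gives goodness. *)
have swap k0 u : Uplus A (gammas d k0) u ->
    (mdeg (mnm_of (d k0)) <= mdeg u)%N /\
    (mdeg u = mdeg (mnm_of (d k0)) -> forall i, (u i < p)%N).
  move=> uP; pose v k j : nat := if k == k0 then u j else d k j.
  have Mv : M (lattice_value p A v).
    congr (M _): Mg; rewrite gammas_value; apply: eq_bigr => k _; congr (_ *+ _).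
    rewrite /v; case: eqP => [->|//].
    by have := dplus k0; rewrite /Uplus /= -uP; under eq_bigr do rewrite mnmE.
  have Ev : (\sum_k \sum_j v k j + mdeg (mnm_of (d k0)) = w + mdeg u)%N.
    rewrite -wd (bigD1 k0) //= [in RHS](bigD1 k0) //= mdeg_mnm_of mdegE /v eqxx.
    rewrite addnAC [RHS]addnAC; congr addn; first exact: addnC.
    by apply: eq_bigr => k /negPf->.
  have [le_w eq_w] := carry p_gt1 Mv; split.
    by rewrite -(leq_add2l w) -Ev leq_add2r.
  move=> Eu i; have := eq_w _ k0 i; rewrite /v eqxx; apply.
  by apply: (@addIn (mdeg (mnm_of (d k0)))); rewrite -/v Ev Eu.
have dweight k : mdeg (mnm_of (d k)) = weight A (gammas d k).
  apply/eqP; rewrite eqn_leq weight_le // andbT.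
  have [|u [uP <-]] := @Umin_exists _ _ A (gammas d k); first by exists (mnm_of (d k)).
  by have [] := swap k u uP.
split=> [|k]; last by split.
split=> // [k|]; last first.
  by rewrite -wd; apply: eq_bigr => k _; rewrite -dweight mdeg_mnm_of.
split; first by exists (mnm_of (d k)).
move=> u [uP uw] i; have [_ /(_ _ i)] := swap k u uP.
by rewrite dweight => /(_ uw); lia.
Qed.

(** Collecting the powers of [lam j] over all places rebuilds the exponent from its digits. *)
Lemma prod_digit_term (d : D) :
  \prod_(k < a) digit_term k (d k) =
  \prod_j ((digit_fact p a (assemble p_gt1 d j))%:R^-1 * lam j ^+ assemble p_gt1 d j).
Proof.
rewrite /digit_term exchange_big /=; apply: eq_bigr => j _.
rewrite big_split /= digit_fact_assemble natr_prod prodfV; congr (_ * _).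
rewrite assembleE expr_sum; apply: eq_bigr => k _.
by rewrite -exprM mulnC.
Qed.

Lemma eval_hasse : eval_Fp charF (hasse p a A M) lam =
  (-1) ^+ n *
   \sum_(u : {ffun 'I_N -> 'I_q} | `[< @UM p a n N A M u >] && (wp u == w))
     \prod_j ((digit_fact p a (u j))%:R^-1 * lam j ^+ u j).
Proof.
rewrite /hasse [LHS]eval_FpM; congr (_ * _).
  by rewrite /eval_Fp !rmorphXn /= !rmorphN1.
(* A finite enumeration of [GammaM]: goodness makes each of its sequences the image under [gammas]
   of some rows of digits. *)
pose r := [seq g <- undup [seq gammas d | d <- enum {: D}] | `[< @GammaM p a n N A M g
  >]].
have r_uniq : uniq r by rewrite filter_uniq ?undup_uniq.
have gammasP (g : {ffun 'I_a -> 'rV[int]_n}) (d : D) :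
    (forall k, Umin A (g k) (mnm_of (d k))) -> g = gammas d.
  move=> gd; apply/ffunP => k; rewrite ffunE.
  by have [/Uplus_mnm_of] := gd k.
have memr g : (g \in r) = `[< @GammaM p a n N A M g >].
  rewrite mem_filter; case: asboolP => //= -[gNA _ _]; rewrite mem_undup.
  have /choice[d dP] : forall k, exists v : {ffun 'I_N -> 'I_p}, Umin A (g k) (mnm_of v).
    move=> k; have [gk gk_good] := gNA k; have [u uP] := Umin_exists gk.
    by have [v _ vP] := good_Umin p_gt0 gk_good uP; exists v.
  rewrite (gammasP g [ffun k => d k]); first by rewrite map_f ?mem_enum.
  by move=> k; rewrite ffunE.
rewrite (fsbigE r) //; first last.
- by move=> g gM; rewrite memr => /asboolPn.
- by move=> g /=; rewrite memr => /asboolP.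
rewrite (big_morph _ eval_FpD eval_Fp0).
rewrite big_seq_cond.
(* The product of sums over minimal representations is expanded into a sum over families [d] of
   rows. *)
transitivity (\sum_(g <- r) \sum_(d : D | [forall k, `[< Umin A (g k) (mnm_of (d k)) >]])
    \prod_(k < a) digit_term k (d k)).
  rewrite [RHS]big_seq; apply: eq_big => [g|g /andP[]].
    rewrite memr; case: asboolP => //= gM; exact/mem_set.
  rewrite memr => /asboolP[gNA _ _] _; rewrite (big_morph _ eval_FpM eval_Fp1).
  rewrite (eq_bigr _ (fun (k : 'I_a) _ => eval_Fpoly k (gNA k).2)).
  rewrite bigA_distr_big_dep; apply: eq_bigl => d.
  by apply/familyP/forallP => dP k; have := dP k; rewrite inE.
(* For a fixed [d] only [g = gammas d] can contribute, and by [minimal_digits] it does so exactly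
   when [d] assembles to a [u] of minimal weight in [U_M]. *)
rewrite (exchange_big_dep xpredT) //=.
rewrite [RHS](reindex (assemble p_gt1 (a := a) (N := N)));
  last exact/onW_bij/assemble_bij.
rewrite [RHS]big_mkcond; apply: eq_bigr => d _.
case: ifPn => [/andP[/asboolP dU /eqP dw]|nd].
  have [gM gmin] := (minimal_digits d).1 (conj dU dw).
  rewrite -prod_digit_term big_mkcond (bigD1_seq (gammas d)) ?memr //=;
    last exact/asboolP.
  rewrite ifT; last by apply/forallP => k; apply/asboolP.
  rewrite [X in _ + X]big1 ?addr0 // => g /negP gd; case: ifP => // /forallP gP; case: gd.
  by apply/eqP/gammasP => k; apply/asboolP.
rewrite big_seq_cond big1 // => g /andP[]; rewrite memr => /asboolP gM /forallP gP.
have gE : g = gammas d by apply: gammasP => k; apply/asboolP.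
case/negP: nd; have [|dU dw] := (minimal_digits d).2.
  by rewrite -gE; split=> // k; apply/asboolP.
by apply/andP; split; [apply/asboolP|apply/eqP].
Qed.

End HasseEvaluation.

(** * The residue of [S] divided by [pi ^+ w], and its valuation *)

Theorem theorem6p6 (p a n N : nat) (pr : prime p)
  (F : finFieldType) (cardF : #|F| = (p ^ a)%N)
  (K : fieldExtType (padic_field pr)) (ord : K -> \bar rat)
  (pi zp zq : K) (red : K -> F) (omega : F -> K)
  (A : 'I_N -> 'rV[int]_n) (e : 'rV[int]_n) :
  is_ordp ord ->
  p.-primitive_root zp ->
  ((p ^ a).-1).-primitive_root zq ->
  <<1 & [:: zp; zq]>>%VS = fullv ->
  pi ^+ p.-1 = - p%:R ->
  cong ord (pi ^+ 2) zp (1 + pi) ->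
  residue_map ord pi red ->
  is_teichmuller ord red omega ->
  let charF := card_finPcharP cardF pr in
  let M := latticeM p a e in
  let w := wpM p a A M in
  let H := hasse p a A M in
  @UM p a n N A M !=set0 ->
  forall lam : 'I_N -> F,
    let S := expsum charF zp omega A e lam in
    [/\ integers ord (pi ^- w * S),
        red (pi ^- w * S) = eval_Fp charF H lam,
        eval_Fp charF H lam != 0 ->
          ord S = (w%:R / p.-1%:R : rat)%:E &
        eval_Fp charF H lam = 0 ->
          ((w%:R / p.-1%:R : rat)%:E < ord S)%E].
Proof.
move=> ordP zpP _ _ piP zp_pi redP omegaP charF M w H _ lam S.
(* This leading term consists of integrality and the residue; the two statements on the order follow
   from whether the residue vanishes. *)
have ldS : lead ord pi red w S (eval_Fp charF H lam).
  rewrite (eval_hasse pr cardF).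
  exact: (lead_expsum cardF charF ordP zpP piP zp_pi redP omegaP).
have [Si Sred] := ldS; split=> // [H0|H0].
  exact: (lead_ord_eq ordP redP piP ldS).
by apply: (lead_ord_gt ordP redP piP); rewrite -H0.
Qed.
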